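(* Assume (C1)–(C5) of the context. There exists at most one strict viscosity solution of the Bellman equation (see context) in the class of functions on $[0,T]\times\mathscr{P}_2(\mathbb{R}^d)$ that are uniformly continuous on each bounded set.
   Context: **Spaces.** $\mathscr{P}_2(\mathbb{R}^d)$ is the space of Borel probability measures on $\mathbb{R}^d$ with finite second moment, with the 2-Wasserstein metric $W_2$; $\varsigma(m):=\big(\int|x|^2m(dx)\big)^{1/2}$. $\mathbb{R}^{d*}$ denotes row vectors. $\mathscr{L}_2(\mu)$ (resp. $\mathscr{L}_2^*(\mu)$) is the space of $\mu$-square-integrable maps $\mathbb{R}^d\to\mathbb{R}^d$ (resp. $\mathbb{R}^d\to\mathbb{R}^{d*}$), $\langle p,v\rangle_\mu:=\int p(x)v(x)\mu(dx)$, $\|(\theta,v)\|:=(\theta^2+\|v\|_{\mathscr{L}_2(\mu)}^2)^{1/2}$. $h\sharp m$ is the push-forward. $\operatorname{UC}(X)$ is the set of real functions on a metric space $X$ uniformly continuous on each bounded subset; $\operatorname{USCB}(X)$ (resp. $\operatorname{LSCB}(X)$) is the set of real functions that are upper (resp. lower) semicontinuous and bounded from above (resp. below) on each bounded set; $[0,T]\times\mathscr{P}_2(\mathbb{R}^d)$ carries the metric $(|t-s|^2+W_2^2(\nu,\mu))^{1/2}$. **Standing assumptions.** $T>0$, $f:[0,T]\times\mathbb{R}^d\times\mathscr{P}_2(\mathbb{R}^d)\times U\to\mathbb{R}^d$, $L:[0,T]\times\mathscr{P}_2(\mathbb{R}^d)\times U\to\mathbb{R}$, $G:\mathscr{P}_2(\mathbb{R}^d)\to\mathbb{R}$.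 (C1) $U$ is a compact metric space. (C2) There is a continuous $\omega_f:[0,\infty)\to[0,\infty)$ with $\omega_f(0)=0$ and $|f(s,x,m,u)-f(r,x,m,u)|\le\omega_f(|s-r|)(1+|x|+\varsigma(m))$ for all $s,r,x,m,u$. (C3) $f$ is uniformly Lipschitz continuous with respect to $x$ and $m$. (C4) $L$ is continuous, and uniformly Lipschitz continuous with respect to $m$. (C5) $G\in\operatorname{UC}(\mathscr{P}_2(\mathbb{R}^d))$. **Bellman equation.** With $H(s,\mu,p):=\min_{u\in U}\big[\int p(x)f(s,x,\mu,u)\mu(dx)+L(s,\mu,u)\big]$ for $p\in\mathscr{L}_2^*(\mu)$, the Bellman equation is $\partial_t\varphi+H(t,\mu,\nabla_\mu\varphi)=0$. This equation is endowed with the boundary condition $\varphi(T,\mu)=G(\mu)$. **Directional $\varepsilon$-differentials.** For $s\in(0,T)$, $\varepsilon\ge0$, $\partial^-_{D,\varepsilon}\phi(s,\mu)$ is the set of $(a,p)\in\mathbb{R}\times\mathscr{L}_2^*(\mu)$ such that for every $(\theta,v)\in\mathbb{R}\times\mathscr{L}_2(\mu)$ $$\liminf_{h\downarrow0,(\theta',v')\to(\theta,v)}\tfrac1h\big[\phi(s+h\theta',(\mathrm{Id}+hv')\sharp\mu)-\phi(s,\mu)-h(a\theta'+\langle p,v'\rangle_\mu)\big]\ge-\varepsilon\|(\theta,v)\|;$$ $\partial^+_{D,\varepsilon}\phi(s,\mu)$ is the set of $(a,p)$ for which, for every $(\theta,v)$, the corresponding $\limsup$ is $\le\varepsilon\|(\theta,v)\|$.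 **Strict viscosity solutions.** $\varphi\in\operatorname{USCB}([0,T]\times\mathscr{P}_2(\mathbb{R}^d))$ is a strict viscosity subsolution if for every bounded $D\subset\mathscr{P}_2(\mathbb{R}^d)$ there is $C(D)\ge0$ such that $a+H(s,\mu,p)\ge-C(D)\varepsilon$ for all $s\in(0,T)$, $\mu\in D$, $\varepsilon>0$, $(a,p)\in\partial^+_{D,\varepsilon}\varphi(s,\mu)$. $\varphi\in\operatorname{LSCB}([0,T]\times\mathscr{P}_2(\mathbb{R}^d))$ is a strict viscosity supersolution if for every bounded $D$ there is $C(D)\ge0$ such that $a+H(s,\mu,p)\le C(D)\varepsilon$ for all $s\in(0,T)$, $\mu\in D$, $\varepsilon>0$, $(a,p)\in\partial^-_{D,\varepsilon}\varphi(s,\mu)$. A continuous $\varphi$ that is both is a strict viscosity solution. *)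

(* Defs.v *)
From HB Require Import structures.
From mathcomp Require Import all_boot all_order all_algebra.
From mathcomp Require Import all_classical all_reals all_analysis.
From mathcomp Require Import measurable_realfun.
From mathcomp Require Import ring lra.

Set Implicit Arguments.
Unset Strict Implicit.
Unset Printing Implicit Defensive.

Import Order.TTheory GRing.Theory Num.Theory.
Import numFieldNormedType.Exports.

Local Open Scope classical_set_scope.
Local Open Scope ring_scope.

(* Matrices with their Borel sigma-algebra. Points of R^d are columns
   [borel R d 1]; row vectors are [borel R 1 d]. *)
Definition borel (R : realType) (m n : nat) :=
  g_sigma_algebraType (@open 'M[R]_(m, n)).

Notation colv R d := (borel R d 1).
Notation rowv R d := (borel R 1 d).

(* The Euclidean norm of rows and columns; the norm that the library puts on
   matrices is the sup norm. *)
Definition enorm (R : realType) (m n : nat) (x : 'M[R]_(m, n)) : R :=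
  Num.sqrt (\sum_i \sum_j x i j ^+ 2).

Section BorelMatrices.
Context {R : realType}.

Lemma measurable_coord m n i j :
  measurable_fun [set: borel R m n] (fun x : borel R m n => x i j : R).
Proof.
apply: (measurability _ (RGenOpens.measurableE R)).
move=> _ [_ [a [b ->] <-]]; rewrite setTI; apply: sub_sigma_algebra.
apply: open_comp; last exact: interval_open.
by move=> x _; exact: coord_continuous.
Qed.

Lemma measurable_mxP {d} {T : measurableType d} {m n} (g : T -> borel R m n) :
  (forall i j, measurable_fun [set: T] (fun x => g x i j : R)) ->
  measurable_fun [set: T] g.
Proof.
move=> mg; apply: (@measurability _ _ T (borel R m n) setT g (@open 'M[R]_(m, n))) => //.
move=> _ [U oU <-]; rewrite setTI.
pose rad (k : nat) : R := k.+1%:R^-1.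
have rad_gt0 k : 0 < rad k by rewrite invr_gt0 ltr0n.
pose box (qk : 'M[rat]_(m, n) * nat) : set 'M[R]_(m, n) :=
  [set y | forall i j, ball (ratr (qk.1 i j) : R) (rad qk.2) (y i j)].
pose F (qk : 'M[rat]_(m, n) * nat) : set T :=
  if `[< box qk `<=` U >] then g @^-1` box qk else set0.
have -> : g @^-1` U = \bigcup_qk F qk.
  apply/seteqP; split=> [x Ux|x [qk _]]; last first.
    by rewrite /F; case: asboolP => // sub; exact: sub.
  have /nbhs_ballP[e /= e0 eU] : nbhs (g x : 'M[R]_(m, n)) U.
    by apply: open_nbhs_nbhs; split.
  have [k ke] : exists k, rad k < e / 2.
    have [k _ kP] : \forall k \near \oo, rad k < e / 2.
      by apply: near_infty_natSinv_lt (PosNum (divr_gt0 e0 (ltr0n R 2))).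
    by exists k; apply: (kP k) => /=.
  have q_ex i j : {q : rat | ball (ratr q : R) (rad k) (g x i j)}.
    apply: cid.
    have [|q] := @rat_in_itvoo R (g x i j - rad k) (g x i j + rad k).
      by rewrite ltrD2l gtrN.
    rewrite in_itv/= => /andP[q1 q2]; exists q.
    by rewrite /ball/= ltr_distl; apply/andP; split; lra.
  pose q := \matrix_(i, j) sval (q_ex i j).
  exists (q, k) => //; rewrite /F; case: asboolP => [_|].
    by move=> i j /=; rewrite mxE; exact: (svalP (q_ex i j)).
  case=> y yb; apply: eU; split=> // i j.
  have /= := yb i j; rewrite mxE => yq.
  have gq := svalP (q_ex i j).
  by move: gq yq; rewrite /ball/= !ltr_distl => /andP[? ?] /andP[? ?];
    apply/andP; split; lra.
apply: countable_bigcupT_measurable; first exact: countableP.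
move=> qk; rewrite /F; case: asboolP => // _.
have -> : g @^-1` box qk = \bigcap_(ij in [set: 'I_m * 'I_n])
    (fun x => g x ij.1 ij.2) @^-1` ball (ratr (qk.1 ij.1 ij.2) : R) (rad qk.2).
  apply/seteqP; split=> [x gx ij _|x gx i j]; first exact: gx.
  exact: (gx (i, j)).
apply: fin_bigcap_measurable; first exact: finite_finset.
move=> ij _; rewrite -[X in measurable X]setTI; apply: mg => //.
exact: measurable_ball.
Qed.

Lemma measurable_enorm2 m n :
  measurable_fun [set: borel R m n]
    (fun x : borel R m n => enorm (x : 'M[R]_(m, n)) ^+ 2).
Proof.
have -> : (fun x : borel R m n => enorm (x : 'M[R]_(m, n)) ^+ 2) =
    (fun x : borel R m n => \sum_i \sum_j (x i j : R) ^+ 2).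
  apply/funext => x; rewrite sqr_sqrtr//.
  by apply: sumr_ge0 => i _; apply: sumr_ge0 => j _; exact: sqr_ge0.
apply: measurable_sum => i; apply: measurable_sum => j.
by apply: measurable_funX; exact: measurable_coord.
Qed.

Lemma enorm2D m n (x y : 'M[R]_(m, n)) :
  enorm (x + y) ^+ 2 <= 2 * (enorm x ^+ 2 + enorm y ^+ 2).
Proof.
have sq (z : 'M[R]_(m, n)) : enorm z ^+ 2 = \sum_i \sum_j z i j ^+ 2.
  rewrite sqr_sqrtr//.
  by apply: sumr_ge0 => i _; apply: sumr_ge0 => j _; exact: sqr_ge0.
rewrite !sq -big_split mulr_sumr; apply: ler_sum => i _.
rewrite -big_split mulr_sumr; apply: ler_sum => j _; rewrite mxE /=.
have := sqr_ge0 (x i j - y i j); nra.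
Qed.

Lemma enorm2Z m n (a : R) (x : 'M[R]_(m, n)) :
  enorm (a *: x) ^+ 2 = a ^+ 2 * enorm x ^+ 2.
Proof.
have sq (z : 'M[R]_(m, n)) : enorm z ^+ 2 = \sum_i \sum_j z i j ^+ 2.
  rewrite sqr_sqrtr//.
  by apply: sumr_ge0 => i _; apply: sumr_ge0 => j _; exact: sqr_ge0.
rewrite !sq mulr_sumr; apply: eq_bigr => i _.
by rewrite mulr_sumr; apply: eq_bigr => j _; rewrite mxE exprMn.
Qed.

End BorelMatrices.

(* Two elements of [P2 R d] with the same values on Borel sets are at
   W2-distance 0, but they need not be equal as terms: a library measure also
   has (irrelevant) values on nonmeasurable sets. *)
Record P2 (R : realType) (d : nat) := MkP2 {
  P2_prob :> probability (colv R d) R ;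
  P2_fin : (\int[P2_prob]_x (enorm x ^+ 2)%:E < +oo)%E }.

Section Spaces.
Context {R : realType} {d : nat}.
Implicit Types mu nu : P2 R d.

Definition L2norm mu (m n : nat) (g : colv R d -> 'M[R]_(m, n)) : R :=
  Num.sqrt (\int[mu]_x (enorm (g x) ^+ 2)).

Definition varsigma mu : R := L2norm mu (fun x => x).

Definition couplings mu nu : set (probability (colv R d * colv R d)%type R) :=
  [set pi | forall A : set (colv R d), measurable A ->
     pi (fst @^-1` A) = mu A /\ pi (snd @^-1` A) = nu A].

(* The infimum is taken in the extended reals; it is finite because the product
   of mu and nu is a coupling of finite cost. *)
Definition W2 mu nu : R :=
  Num.sqrt (fine (ereal_inf
    [set (\int[pi]_z (enorm (z.1 - z.2 : 'cV[R]_d) ^+ 2)%:E)%E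
    | pi in couplings mu nu])).

Record L2maps mu (m n : nat) := MkL2 {
  L2_fun :> {mfun colv R d >-> borel R m n} ;
  L2_fin : (\int[mu]_x (enorm (L2_fun x) ^+ 2)%:E < +oo)%E }.

Definition L2 mu := L2maps mu d 1.

Definition L2star mu := L2maps mu 1 d.

Definition pairing mu (p : colv R d -> 'rV[R]_d) (v : colv R d -> 'cV[R]_d) : R :=
  \int[mu]_x (p x *m v x) 0 0.

Definition tnorm mu (theta : R) (v : colv R d -> 'cV[R]_d) : R :=
  Num.sqrt (theta ^+ 2 + L2norm mu v ^+ 2).

Definition id_plus mu (h : R) (v : L2 mu) : colv R d -> colv R d :=
  fun x => (x : 'cV[R]_d) + h *: (v x : 'cV[R]_d).

Lemma measurable_id_plus mu (h : R) (v : L2 mu) :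
  measurable_fun [set: colv R d] (id_plus h v).
Proof.
apply: measurable_mxP => i j.
have -> : (fun x : colv R d => id_plus h v x i j) =
    (fun x : colv R d => (x i j : R)) \+ (fun x : colv R d => h * (v x i j : R)).
  by apply/funext => x; rewrite /id_plus !mxE.
apply: measurable_funD; first exact: measurable_coord.
apply: measurable_funM; first exact: measurable_cst.
by apply: (measurableT_comp (@measurable_coord R d 1 i j)).
Qed.

HB.instance Definition _ mu (h : R) (v : L2 mu) :=
  isMeasurableFun.Build _ _ _ _ (id_plus h v) (measurable_id_plus h v).

Lemma id_plus_fin mu (h : R) (v : L2 mu) :
  (\int[distribution mu (id_plus h v)]_x (enorm x ^+ 2)%:E < +oo)%E.
Proof.
have mv : measurable_fun [set: colv R d] (fun x => (enorm (v x) ^+ 2)%:E).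
  apply/measurable_EFinP.
  by apply: (measurableT_comp (@measurable_enorm2 R d 1)).
have mi : measurable_fun [set: colv R d] (fun x : colv R d => (enorm x ^+ 2)%:E).
  by apply/measurable_EFinP; exact: measurable_enorm2.
have h2 : 0 <= 2 * h ^+ 2 by rewrite mulr_ge0// sqr_ge0.
rewrite ge0_integral_distribution//; last first.
  by move=> x; rewrite lee_fin sqr_ge0.
apply: (@le_lt_trans _ _ (\int[mu]_x (2%:E * (enorm x ^+ 2)%:E +
    (2 * h ^+ 2)%:E * (enorm (v x) ^+ 2)%:E))%E).
  apply: ge0_le_integral => //=.
  - by move=> x _; rewrite lee_fin sqr_ge0.
  - by apply: (measurableT_comp mi); exact: measurable_id_plus.
  - by apply: emeasurable_funD; apply: measurable_funeM.
  - move=> x _; rewrite -!EFinM -EFinD lee_fin -mulrA -mulrDr -enorm2Z.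
    exact: enorm2D.
rewrite ge0_integralD//=.
- rewrite !ge0_integralZl//=.
  + apply: lte_add_pinfty.
      by rewrite lte_mul_pinfty// ?lee_fin//; exact: P2_fin.
    by apply: lte_mul_pinfty; [rewrite lee_fin|by []|exact: L2_fin].
  + by move=> x _; rewrite lee_fin sqr_ge0.
  + by move=> x _; rewrite lee_fin sqr_ge0.
- by move=> x _; rewrite -EFinM lee_fin mulr_ge0// sqr_ge0.
- exact: measurable_funeM.
- by move=> x _; rewrite -EFinM lee_fin mulr_ge0// sqr_ge0.
- exact: measurable_funeM.
Qed.

Definition push mu (h : R) (v : L2 mu) : P2 R d := MkP2 (id_plus_fin h v).

End Spaces.

(* Notions on a space X with a distance function, relative to a subset E: the
   functions are defined on all of X but only their values on E matter.
   No topology is declared on P2: W2 is not separated on terms (see P2). *)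
Section MetricFunctions.
Context {R : realType} {X : Type} (dist : X -> X -> R).

Definition dist_bounded (D : set X) : Prop :=
  exists r : R, forall x y, D x -> D y -> dist x y <= r.

Definition continuous_on (E : set X) (phi : X -> R) : Prop :=
  forall x, E x -> forall e, 0 < e -> exists2 del, 0 < del &
    forall y, E y -> dist x y < del -> `|phi x - phi y| < e.

Definition UC (E : set X) (phi : X -> R) : Prop :=
  forall D, D `<=` E -> dist_bounded D ->
  forall e, 0 < e -> exists2 del, 0 < del &
    forall x y, D x -> D y -> dist x y < del -> `|phi x - phi y| < e.

Definition USCB (E : set X) (phi : X -> R) : Prop :=
  (forall x, E x -> forall e, 0 < e -> exists2 del, 0 < del &
     forall y, E y -> dist x y < del -> phi y < phi x + e) /\
  (forall D, D `<=` E -> dist_bounded D ->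
     exists M, forall x, D x -> phi x <= M).

Definition LSCB (E : set X) (phi : X -> R) : Prop :=
  (forall x, E x -> forall e, 0 < e -> exists2 del, 0 < del &
     forall y, E y -> dist x y < del -> phi x - e < phi y) /\
  (forall D, D `<=` E -> dist_bounded D ->
     exists M, forall x, D x -> M <= phi x).

End MetricFunctions.

(* [0,T] x P_2(R^d) is the subset [tspace T] of R * P2 R d. *)
Definition tspace (R : realType) (d : nat) (T : R) : set (R * P2 R d) :=
  [set z | 0 <= z.1 <= T].

Definition tdist (R : realType) (d : nat) (y z : R * P2 R d) : R :=
  Num.sqrt (`|y.1 - z.1| ^+ 2 + W2 y.2 z.2 ^+ 2).

Section Differentials.
Context {R : realType} {d : nat}.
Implicit Types (phi : R * P2 R d -> R) (mu : P2 R d).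

Definition diff_quot phi (s : R) mu (a : R) (p : L2star mu)
    (h theta : R) (v : L2 mu) : R :=
  h^-1 * (phi (s + h * theta, push h v) - phi (s, mu)
          - h * (a * theta + pairing mu p v)).

(* Basic neighbourhoods for the passage h -> 0+, (theta', v') -> (theta, v). *)
Definition dir_nbhs mu (theta : R) (v : L2 mu) (del : R) : set (R * R * L2 mu) :=
  [set z : R * R * L2 mu | 0 < z.1.1 < del /\
     tnorm mu (z.1.2 - theta) (fun x => (z.2 x : 'cV[R]_d) - v x) < del].

Definition dir_liminf mu (theta : R) (v : L2 mu) (q : R -> R -> L2 mu -> R) : \bar R :=
  ereal_sup [set ereal_inf [set (q z.1.1 z.1.2 z.2)%:E | z in dir_nbhs theta v del]
            | del in [set del : R | 0 < del]].

Definition dir_limsup mu (theta : R) (v : L2 mu) (q : R -> R -> L2 mu -> R) : \bar R :=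
  ereal_inf [set ereal_sup [set (q z.1.1 z.1.2 z.2)%:E | z in dir_nbhs theta v del]
            | del in [set del : R | 0 < del]].

Definition subdiff (eps : R) phi (s : R) mu : set (R * L2star mu) :=
  [set ap | forall (theta : R) (v : L2 mu),
     ((- (eps * tnorm mu theta v))%:E <=
       dir_liminf theta v (diff_quot phi s ap.1 ap.2))%E].

Definition superdiff (eps : R) phi (s : R) mu : set (R * L2star mu) :=
  [set ap | forall (theta : R) (v : L2 mu),
     (dir_limsup theta v (diff_quot phi s ap.1 ap.2) <=
       (eps * tnorm mu theta v)%:E)%E].

End Differentials.

Section Bellman.
Context {R : realType} {d : nat} {U : metricType R}.
Variables (T : R) (f : R -> 'cV[R]_d -> P2 R d -> U -> 'cV[R]_d).
Variables (L : R -> P2 R d -> U -> R) (G : P2 R d -> R).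

Definition C1 : Prop := [set: U] !=set0 /\ compact [set: U].

Definition C2 : Prop := exists omega : R -> R,
  [/\ {within `[0, +oo[, continuous omega},
      forall r, 0 <= r -> 0 <= omega r,
      omega 0 = 0 &
      forall s r x m u, 0 <= s <= T -> 0 <= r <= T ->
        enorm (f s x m u - f r x m u) <=
          omega `|s - r| * (1 + enorm x + varsigma m)].

Definition C3 : Prop := exists2 K : R, 0 <= K &
  forall s x y m n u, 0 <= s <= T ->
    enorm (f s x m u - f s y n u) <= K * (enorm (x - y) + W2 m n).

Definition C4 : Prop :=
  (forall s m u, 0 <= s <= T -> forall e, 0 < e -> exists2 del, 0 < del &
     forall r n w, 0 <= r <= T -> `|s - r| < del -> W2 m n < del ->
       mdist u w < del -> `|L s m u - L r n w| < e) /\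
  (exists2 K : R, 0 <= K &
     forall s m n u, 0 <= s <= T -> `|L s m u - L s n u| <= K * W2 m n).

Definition C5 : Prop := UC (@W2 R d) setT G.

(* The infimum is the minimum whenever the latter exists. It is taken in the
   extended reals because C1-C5 contain no continuity of f in u, so that the
   infimum could be -oo. *)
Definition hamiltonian (s : R) (mu : P2 R d) (p : L2star mu) : \bar R :=
  ereal_inf [set (\int[mu]_x (p x *m f s x mu u) 0 0 + L s mu u)%:E | u in setT].

Definition strict_subsolution (phi : R * P2 R d -> R) : Prop :=
  USCB (@tdist R d) (tspace T) phi /\
  forall D : set (P2 R d), dist_bounded (@W2 R d) D ->
  exists2 C : R, 0 <= C &
    forall s mu eps (a : R) (p : L2star mu), 0 < s < T -> D mu -> 0 < eps ->
      superdiff eps phi s (a, p) ->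
      ((- (C * eps))%:E <= a%:E + hamiltonian s p)%E.

Definition strict_supersolution (phi : R * P2 R d -> R) : Prop :=
  LSCB (@tdist R d) (tspace T) phi /\
  forall D : set (P2 R d), dist_bounded (@W2 R d) D ->
  exists2 C : R, 0 <= C &
    forall s mu eps (a : R) (p : L2star mu), 0 < s < T -> D mu -> 0 < eps ->
      subdiff eps phi s (a, p) ->
      (a%:E + hamiltonian s p <= (C * eps)%:E)%E.

Definition strict_solution (phi : R * P2 R d -> R) : Prop :=
  [/\ continuous_on (@tdist R d) (tspace T) phi,
      strict_subsolution phi, strict_supersolution phi &
      forall mu, phi (T, mu) = G mu].

End Bellman.

(* Main.v *)
(* Everything is lifted to the space L2(mu; R^d) of random variables on the
   probability space (R^d, mu), where mu is the measure at which the two solutions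
   are to be compared: phi(t, m) becomes phi(t, law X), and W2(law X, law Y) is at
   most |X - Y|. Tangent vectors at X project, by conditional expectation given
   X, onto epsilon-differentials at law X, so that no optimal coupling is needed.
   In L2, which is complete but not locally compact, Ekeland's principle replaces
   the maximum points of the doubling-of-variables argument: the Lipschitz
   perturbation of slope eta that it leaves behind is exactly what the
   epsilon-differentials of a strict solution tolerate. A smooth cone penalty
   localizes the comparison on a short time interval, whose length depends only
   on the linear growth of f; finitely many steps back from T conclude. *)
Require Import Defs.
From HB Require Import structures.
From mathcomp Require Import all_boot all_order all_algebra.
From mathcomp Require Import all_classical all_reals all_analysis.
From mathcomp Require Import measurable_realfun.
From mathcomp Require Import ring lra.

Set Implicit Arguments.
Unset Strict Implicit.
Unset Printing Implicit Defensive.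

Import Order.TTheory GRing.Theory Num.Theory.
Import numFieldNormedType.Exports.

Local Open Scope classical_set_scope.
Local Open Scope ring_scope.

(** * Square-integrable maps *)

(** The squared norm of L2(mu) is an exact quadratic, so each smooth penalty has an explicit linear
    part and a second-order remainder. On a small enough ball this remainder is absorbed into the
    slope eta, however large the coefficients are. The constants C(D) belong to one ball of laws
    fixed beforehand; hence eta is chosen against them first, and the coefficients alpha (in space)
    and beta (in time) are chosen later as finite numbers, with no passage to the limit. The order
    matters: alpha multiplies the time modulus of f, so beta must come after alpha. The cone opens
    forward in time from (t0, X0), like the domain of dependence of a backward equation. While 1 +
    |X| <= 2 R0 and |X - X0| <= R0, the drift changes |X - X0|^2 at a rate of at most 2 R0 * c0 * 2
    R0 = 4 c0 R0^2. Taking this number as the speed of the cone makes the time derivative of the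
    penalty compensate its drift term, whatever its coefficient. The radius R0 scales out of the
    condition on the step length, which involves only c0. *)

Section SquareIntegrable.
Context {R : realType} {d : nat}.
Implicit Types (mu : P2 R d) (g k l : colv R d -> 'cV[R]_d) (a c : R).

Definition dot (x y : 'cV[R]_d) : R := \sum_i x i 0 * y i 0.

(** A predicate on plain functions, so that sums, multiples and compositions need no repackaging as
    elements of [L2 mu]; [L2_of] goes back where an element is required. *)
Definition sqint mu g : Prop :=
  measurable_fun [set: colv R d] (g : colv R d -> borel R d 1) /\
  (\int[mu]_x (enorm (g x) ^+ 2)%:E < +oo)%E.

Definition ip mu g k : R := \int[mu]_x dot (g x) (k x).

Lemma dotC (x y : 'cV[R]_d) : dot x y = dot y x.
Proof. by apply: eq_bigr => i _; rewrite mulrC. Qed.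

Lemma dotDl (x y z : 'cV[R]_d) : dot (x + y) z = dot x z + dot y z.
Proof. by rewrite /dot -big_split; apply: eq_bigr => i _; rewrite mxE mulrDl. Qed.

Lemma dotZl a (x y : 'cV[R]_d) : dot (a *: x) y = a * dot x y.
Proof. by rewrite /dot mulr_sumr; apply: eq_bigr => i _; rewrite mxE mulrA. Qed.

Lemma enorm2_dot (x : 'cV[R]_d) : enorm x ^+ 2 = dot x x.
Proof.
rewrite /enorm sqr_sqrtr.
  by apply: eq_bigr => i _; rewrite big_ord1 expr2.
by apply: sumr_ge0 => i _; apply: sumr_ge0 => j _; exact: sqr_ge0.
Qed.

Lemma enorm_ge0 m n (x : 'M[R]_(m, n)) : 0 <= enorm x.
Proof. exact: sqrtr_ge0. Qed.

Lemma enormN (x : 'cV[R]_d) : enorm (- x) = enorm x.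
Proof. by congr Num.sqrt; apply: eq_bigr => i _; apply: eq_bigr => j _; rewrite mxE sqrrN. Qed.

Lemma dot_le (x y : 'cV[R]_d) : `|dot x y| <= enorm x ^+ 2 + enorm y ^+ 2.
Proof.
rewrite !enorm2_dot /dot -big_split /=; apply: le_trans (ler_norm_sum _ _ _) _.
apply: ler_sum => i _; rewrite ler_norml; apply/andP; split.
  by have := sqr_ge0 (x i 0 + y i 0); have := sqr_ge0 (x i 0); have := sqr_ge0 (y i 0); nra.
by have := sqr_ge0 (x i 0 - y i 0); have := sqr_ge0 (x i 0); have := sqr_ge0 (y i 0); nra.
Qed.

Lemma coord_le (x : 'cV[R]_d) i : `|x i 0| <= enorm x.
Proof.
rewrite -(ler_pXn2r (n := 2)) ?nnegrE ?enorm_ge0// enorm2_dot /dot (bigD1 i)//=.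
rewrite real_normK ?num_real// expr2 lerDl; apply: sumr_ge0 => j _.
by rewrite -expr2 sqr_ge0.
Qed.

Lemma measurable_dot g k :
  measurable_fun [set: colv R d] (g : colv R d -> borel R d 1) ->
  measurable_fun [set: colv R d] (k : colv R d -> borel R d 1) ->
  measurable_fun [set: colv R d] (fun x => dot (g x) (k x)).
Proof.
move=> mg mk; apply: measurable_sum => i; apply: measurable_funM.
  exact: (measurableT_comp (@measurable_coord R d 1 i 0) mg).
exact: (measurableT_comp (@measurable_coord R d 1 i 0) mk).
Qed.

Lemma measurable_enorm2_comp g :
  measurable_fun [set: colv R d] (g : colv R d -> borel R d 1) ->
  measurable_fun [set: colv R d] (fun x => enorm (g x) ^+ 2).
Proof. by move=> mg; exact: (measurableT_comp (@measurable_enorm2 R d 1) mg). Qed.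

Lemma sqint_enorm2 mu g : sqint mu g ->
  mu.-integrable [set: colv R d] (EFin \o (fun x => enorm (g x) ^+ 2)).
Proof.
move=> [mg fg]; apply/integrableP; split.
  by apply/measurable_EFinP; exact: measurable_enorm2_comp.
rewrite (eq_integral (fun x => (enorm (g x) ^+ 2)%:E))// => x _ /=.
by rewrite ger0_norm ?sqr_ge0.
Qed.

Lemma sqint_dot mu g k : sqint mu g -> sqint mu k ->
  mu.-integrable [set: colv R d] (EFin \o (fun x => dot (g x) (k x))).
Proof.
move=> hg hk.
have ib := integrableD measurableT (sqint_enorm2 hg) (sqint_enorm2 hk).
apply: (le_integrable measurableT _ _ ib).
  by apply/measurable_EFinP; apply: measurable_dot; [case: hg|case: hk].
move=> x _ /=; rewrite lee_fin.
by rewrite (le_trans (dot_le _ _))// ler_norm.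
Qed.

Lemma measurable_lin g k a :
  measurable_fun [set: colv R d] (g : colv R d -> borel R d 1) ->
  measurable_fun [set: colv R d] (k : colv R d -> borel R d 1) ->
  measurable_fun [set: colv R d] ((fun x => a *: g x + k x) : colv R d -> borel R d 1).
Proof.
move=> mg mk; apply: measurable_mxP => i j.
rewrite (_ : (fun x => _) = (fun x => a * (g x i j : R)) \+ (fun x => (k x i j : R))); last first.
  by apply/funext => x; rewrite !mxE.
apply: measurable_funD; last exact: (measurableT_comp (@measurable_coord R d 1 i j) mk).
apply: measurable_funM; first exact: measurable_cst.
exact: (measurableT_comp (@measurable_coord R d 1 i j) mg).
Qed.

Lemma sqint_le mu g (b : colv R d -> R) :
  measurable_fun [set: colv R d] (g : colv R d -> borel R d 1) ->
  mu.-integrable [set: colv R d] (EFin \o b) ->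
  (forall x, enorm (g x) ^+ 2 <= b x) -> sqint mu g.
Proof.
move=> mg ib gb; split => //.
have /integrableP[mb fb] := ib.
apply: le_lt_trans fb; apply: ge0_le_integral => //.
- by move=> x _; rewrite lee_fin sqr_ge0.
- by apply/measurable_EFinP; exact: measurable_enorm2_comp.
- exact: (measurableT_comp (@abse_measurable R setT) mb).
- by move=> x _ /=; rewrite lee_fin (le_trans (gb x))// ler_norm.
Qed.

Lemma sqint_lin mu a g k : sqint mu g -> sqint mu k ->
  sqint mu (fun x => a *: g x + k x).
Proof.
move=> hg hk.
have [[mg _] [mk _]] := (hg, hk).
apply: (@sqint_le _ _ (fun x => 2 * a ^+ 2 * enorm (g x) ^+ 2 + 2 * enorm (k x) ^+ 2)).
- exact: measurable_lin.
- apply: (@integrableD _ _ _ _ _ measurableT (EFin \o (fun x => 2 * a ^+ 2 * enorm (g x) ^+ 2))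
     (EFin \o (fun x => 2 * enorm (k x) ^+ 2))).
    exact: (integrableZl measurableT (2 * a ^+ 2) (sqint_enorm2 hg)).
  exact: (integrableZl measurableT 2 (sqint_enorm2 hk)).
- by move=> x; rewrite -mulrA -mulrDr -enorm2Z; exact: enorm2D.
Qed.

Lemma sqint_cst mu (c : 'cV[R]_d) : sqint mu (cst c).
Proof.
apply: (@sqint_le _ _ (fun=> enorm c ^+ 2)) => //.
exact: (finite_measure_integrable_cst mu).
Qed.

Lemma sqintD mu g k : sqint mu g -> sqint mu k -> sqint mu (fun x => g x + k x).
Proof.
move=> hg hk; have := sqint_lin 1 hg hk.
by under eq_fun do rewrite scale1r.
Qed.

Lemma sqintZ mu a g : sqint mu g -> sqint mu (fun x => a *: g x).
Proof.
move=> hg; have := sqint_lin a hg (sqint_cst mu 0).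
by under eq_fun do rewrite addr0.
Qed.

Lemma sqintB mu g k : sqint mu g -> sqint mu k -> sqint mu (fun x => g x - k x).
Proof.
move=> hg hk; have := sqint_lin (-1) hk hg.
by under eq_fun do rewrite scaleN1r addrC.
Qed.

Lemma ipC mu g k : ip mu g k = ip mu k g.
Proof. by apply: eq_Rintegral => x _; rewrite dotC. Qed.

Lemma ip_linl mu a g k l : sqint mu g -> sqint mu k -> sqint mu l ->
  ip mu (fun x => a *: g x + k x) l = a * ip mu g l + ip mu k l.
Proof.
move=> hg hk hl; rewrite /ip.
under eq_Rintegral do rewrite dotDl dotZl.
have i1 := sqint_dot hg hl; have i2 := sqint_dot hk hl.
rewrite RintegralD//; last exact: (integrableZl measurableT a i1).
by rewrite RintegralZl.
Qed.

Lemma ipZl mu a g l : sqint mu g -> sqint mu l ->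
  ip mu (fun x => a *: g x) l = a * ip mu g l.
Proof.
move=> hg hl; rewrite /ip; under eq_Rintegral do rewrite dotZl.
by rewrite RintegralZl//; exact: sqint_dot.
Qed.

Lemma ipBl mu g k l : sqint mu g -> sqint mu k -> sqint mu l ->
  ip mu (fun x => g x - k x) l = ip mu g l - ip mu k l.
Proof.
move=> hg hk hl; rewrite [RHS]addrC -mulN1r -ip_linl//.
by congr (ip mu _ l); apply/funext => x; rewrite scaleN1r addrC.
Qed.

Lemma L2norm_ge0 mu m n (g : colv R d -> 'M[R]_(m, n)) : 0 <= L2norm mu g.
Proof. exact: sqrtr_ge0. Qed.

Lemma L2norm2 mu g : L2norm mu g ^+ 2 = ip mu g g.
Proof.
rewrite /L2norm sqr_sqrtr; last by apply: Rintegral_ge0 => x _; rewrite sqr_ge0.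
by apply: eq_Rintegral => x _; rewrite enorm2_dot.
Qed.

Lemma L2norm_sym mu g k :
  L2norm mu (fun x => g x - k x) = L2norm mu (fun x => k x - g x).
Proof.
by congr Num.sqrt; apply: eq_Rintegral => x _; rewrite -enormN opprB.
Qed.

Lemma L2norm0 mu g : L2norm mu (fun x => g x - g x) = 0.
Proof.
apply/eqP; rewrite -sqrf_eq0 L2norm2 /ip; apply/eqP.
rewrite (eq_Rintegral mu (g := cst 0)) ?Rintegral_cst ?mul0r// => x _.
by rewrite subrr /dot big1// => i _; rewrite mxE mul0r.
Qed.

Lemma L2norm2_lin mu a g k : sqint mu g -> sqint mu k ->
  L2norm mu (fun x => a *: g x + k x) ^+ 2 =
  a ^+ 2 * L2norm mu g ^+ 2 + 2 * a * ip mu g k + L2norm mu k ^+ 2.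
Proof.
move=> hg hk; have hl := sqint_lin a hg hk.
by rewrite !L2norm2 ip_linl// [ip mu g _]ipC [ip mu k _]ipC !ip_linl// (ipC mu k g); ring.
Qed.

Lemma L2norm2D mu g k : sqint mu g -> sqint mu k ->
  L2norm mu (fun x => g x + k x) ^+ 2 =
  L2norm mu g ^+ 2 + 2 * ip mu g k + L2norm mu k ^+ 2.
Proof.
move=> hg hk; have := L2norm2_lin 1 hg hk.
by under eq_fun do rewrite scale1r; move=> ->; ring.
Qed.

Lemma L2norm2B mu g k : sqint mu g -> sqint mu k ->
  L2norm mu (fun x => g x - k x) ^+ 2 =
  L2norm mu g ^+ 2 - 2 * ip mu g k + L2norm mu k ^+ 2.
Proof.
move=> hg hk; have := L2norm2_lin (-1) hk hg.
by under eq_fun do rewrite scaleN1r addrC; move=> ->; rewrite ipC; ring.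
Qed.

Lemma cauchy_schwarz mu g k : sqint mu g -> sqint mu k ->
  `|ip mu g k| <= L2norm mu g * L2norm mu k.
Proof.
move=> hg hk; rewrite -(ler_pXn2r (n := 2)) ?nnegrE ?mulr_ge0 ?L2norm_ge0//.
rewrite real_normK ?num_real// exprMn.
have pos a b : 0 <= a ^+ 2 * L2norm mu g ^+ 2 + 2 * a * b * ip mu g k + b ^+ 2 * L2norm mu k ^+ 2.
  have := sqr_ge0 (L2norm mu (fun x => a *: g x + b *: k x)).
  rewrite L2norm2_lin//; last exact: sqintZ.
  rewrite [ip mu g _]ipC ipZl// (ipC mu k).
  have -> : L2norm mu (fun x => b *: k x) ^+ 2 = b ^+ 2 * L2norm mu k ^+ 2.
    by rewrite !L2norm2 ipZl ?[ip mu k _]ipC ?ipZl//; [ring|exact: sqintZ].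
  by congr (0 <= _); ring.
set A := L2norm mu g ^+ 2; set B := L2norm mu k ^+ 2; set c := ip mu g k.
have A0 : 0 <= A by exact: sqr_ge0.
have B0 : 0 <= B by exact: sqr_ge0.
have [B00|Bn0] := eqVneq B 0.
  have [->|cn0] := eqVneq c 0; first by rewrite B00 mulr0 expr0n.
  (* For [B = 0] the form is affine in its second argument; this choice gives it the negative value
     - A - 2. *)
  have := pos (- 1) ((A + 1) / c); rewrite -/A -/B -/c B00 mulr0 addr0.
  have -> : (-1) ^+ 2 * A + 2 * -1 * ((A + 1) / c) * c = A - 2 * (A + 1) by field.
  by move=> ?; lra.
have Bp : 0 < B by rewrite lt0r Bn0.
have := pos B (- c); rewrite -/A -/B -/c.
have -> : B ^+ 2 * A + 2 * B * - c * c + (- c) ^+ 2 * B = B * (A * B - c ^+ 2) by ring.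
by rewrite pmulr_rge0// subr_ge0.
Qed.

Lemma L2normD mu g k : sqint mu g -> sqint mu k ->
  L2norm mu (fun x => g x + k x) <= L2norm mu g + L2norm mu k.
Proof.
move=> hg hk; rewrite -(ler_pXn2r (n := 2)) ?nnegrE ?addr_ge0 ?L2norm_ge0//.
have := le_trans (ler_norm _) (cauchy_schwarz hg hk).
by rewrite L2norm2D//; nra.
Qed.

Lemma L2normZ mu a g : sqint mu g -> L2norm mu (fun x => a *: g x) = `|a| * L2norm mu g.
Proof.
move=> hg; apply/eqP; rewrite -(eqrXn2 (n := 2)) ?mulr_ge0 ?L2norm_ge0//.
rewrite exprMn real_normK ?num_real// !L2norm2 ipZl ?(ipC mu g) ?ipZl//; last exact: sqintZ.
by apply/eqP; ring.
Qed.

Lemma L2norm_dist mu g k l : sqint mu g -> sqint mu k -> sqint mu l ->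
  L2norm mu (fun x => g x - l x) <=
  L2norm mu (fun x => g x - k x) + L2norm mu (fun x => k x - l x).
Proof.
move=> hg hk hl; have := L2normD (sqintB hg hk) (sqintB hk hl).
by under [X in L2norm mu X <= _]eq_fun do rewrite addrA subrK.
Qed.

Lemma L2norm_EFin mu g : sqint mu g ->
  (\int[mu]_x (enorm (g x) ^+ 2)%:E)%E = (L2norm mu g ^+ 2)%:E.
Proof.
move=> hg; rewrite /L2norm sqr_sqrtr; last by apply: Rintegral_ge0 => x _; rewrite sqr_ge0.
rewrite /Rintegral fineK//.
by have := integrable_fin_num measurableT (sqint_enorm2 hg).
Qed.

Lemma L2norm_le mu g c : 0 <= c -> (\int[mu]_x (enorm (g x) ^+ 2)%:E <= (c ^+ 2)%:E)%E ->
  L2norm mu g <= c.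
Proof.
move=> c0 gc; rewrite -(ler_pXn2r (n := 2)) ?nnegrE ?L2norm_ge0//.
rewrite /L2norm sqr_sqrtr; last by apply: Rintegral_ge0 => x _; rewrite sqr_ge0.
rewrite -lee_fin /Rintegral fineK// ge0_fin_numE ?(le_lt_trans gc) ?ltry//.
by apply: integral_ge0 => x _; rewrite lee_fin sqr_ge0.
Qed.

Lemma sqint_L2 mu (X : L2 mu) : sqint mu (X : colv R d -> borel R d 1).
Proof. by split; [exact: measurable_funP|exact: L2_fin]. Qed.

End SquareIntegrable.

(** * Completeness of L2(mu) *)

Lemma cvgn_geometric_increments (R : realType) (u : nat -> R) (c : R) :
  (forall n, `|u n.+1 - u n| <= c * 2^-1 ^+ n) -> cvgn u.
Proof.
move=> uc.
have -> : u = (fun n => u 0%N + series (telescope u) n).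
  by apply/funext => n; exact: eq_sum_telescope.
apply: is_cvgD; first exact: is_cvg_cst.
apply: normed_cvg; apply: (@series_le_cvg _ _ (geometric c 2^-1)).
- by move=> n; exact: normr_ge0.
- by move=> n; exact: le_trans (normr_ge0 _) (uc n).
- by move=> n; exact: uc.
- by apply: is_cvg_geometric_series; rewrite ger0_norm; lra.
Qed.

Section L2Complete.
Context {R : realType} {d : nat}.
Implicit Types (mu : P2 R d).

(** The subtracted tail is what lets the induction close: one more increment 4^-m is at most 2 *
    4^-m - 2 * 4^-(m+1). *)
Lemma L2norm_increments mu (g : nat -> colv R d -> 'cV[R]_d) n k :
  (forall n, sqint mu (g n)) ->
  (forall n, L2norm mu (fun x => g n.+1 x - g n x) <= 4^-1 ^+ n) ->
  L2norm mu (fun x => g (k + n)%N x - g n x) <= 2 * 4^-1 ^+ n - 2 * 4^-1 ^+ (k + n).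
Proof.
move=> hg gc; elim: k => [|k IH]; first by rewrite add0n L2norm0 subrr.
apply: le_trans (L2norm_dist (hg _) (hg (k + n)%N) (hg _)) _.
apply: le_trans (lerD (gc _) IH) _; rewrite addSn exprS.
have : 0 <= 4^-1 ^+ (k + n) :> R by rewrite exprn_ge0.
by move: (4^-1 ^+ n) (4^-1 ^+ (k + n)) => a b; lra.
Qed.

Lemma L2_complete mu (g : nat -> colv R d -> 'cV[R]_d) :
  (forall n, sqint mu (g n)) ->
  (forall n, L2norm mu (fun x => g n.+1 x - g n x) <= 4^-1 ^+ n) ->
  exists2 h, sqint mu h &
    forall n, L2norm mu (fun x => h x - g n x) <= 2 * 4^-1 ^+ n.
Proof.
move=> hg gc.
have hD n : sqint mu (fun x => g n.+1 x - g n x) by exact: sqintB.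
(* The squared increments have integral at most 16^-n, so the weight 4^n leaves a summable 4^-n.
   Where the weighted sum [S] is finite, the increments are at most sqrt(S) * 2^-n, hence the
   sequence converges there. *)
pose w n x : \bar R := (4 ^+ n * enorm (g n.+1 x - g n x) ^+ 2)%:E.
have w0 n x : (0 <= w n x)%E by rewrite lee_fin mulr_ge0 ?sqr_ge0 ?exprn_ge0.
have mw n : measurable_fun [set: colv R d] (w n).
  apply/measurable_EFinP; apply: measurable_funM; first exact: measurable_cst.
  by apply: measurable_enorm2_comp; case: (hD n).
pose S x : \bar R := (\sum_(n <oo) w n x)%E.
have S0 x : (0 <= S x)%E by apply: nneseries_ge0 => n _ _; exact: w0.
have mS : measurable_fun [set: colv R d] S.
  by apply: (ge0_emeasurable_sum (P := xpredT)) => [n x _ _|n _]; [exact: w0|exact: mw].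
have iS : (\int[mu]_x S x < +oo)%E.
  rewrite integral_nneseries//.
  apply: (@le_lt_trans _ _ (\sum_(n <oo) (2 / (2 ^ (n + 1))%:R : R)%:E)%E).
    apply: lee_nneseries => [n _ _|n _]; first exact: integral_ge0.
    have -> : (\int[mu]_x w n x)%E = (4 ^+ n * L2norm mu (fun x => g n.+1 x - g n x) ^+ 2)%:E.
    rewrite EFinM -(L2norm_EFin (hD n)) -(integralZl measurableT (sqint_enorm2 (hD n))).
    by apply: eq_integral => x _; rewrite -EFinM.
  rewrite lee_fin.
  apply: (@le_trans _ _ (4 ^+ n * (4^-1 ^+ n) ^+ 2)).
    by rewrite ler_wpM2l ?exprn_ge0// ler_pXn2r ?nnegrE ?L2norm_ge0 ?exprn_ge0.
  rewrite expr2 mulrA -exprMn divff// expr1n mul1r.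
  rewrite natrX exprD expr1 invfM mulrCA divff// mulr1 exprVn lef_pV2 ?posrE ?exprn_gt0//.
  by apply: lerXn2r; rewrite ?nnegrE ?ler_nat.
  have c2 : eseries (fun k => (2 / (2 ^ (k + 1))%:R : R)%:E) @ \oo --> (2 / 2 ^+ 0 : R)%:E.
    exact: cvg_geometric_eseries_half.
  by have /cvg_lim := c2; rewrite /eseries /= => ->//; rewrite ltry.
pose A := [set x | S x \is a fin_num].
have mA : measurable A.
  by rewrite -(setTI A); exact: emeasurable_fin_num.
have aeA : {ae mu, forall x, A x}.
  have iS' : mu.-integrable [set: colv R d] S.
    by apply/integrableP; split => //; under eq_integral do rewrite gee0_abs//.
  by have := integrable_ae measurableT iS'; apply: filterS => x; exact.
have cvgA x i : A x -> cvgn (fun n => g n x i 0 : R).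
  move=> Ax; apply: (@cvgn_geometric_increments _ _ (Num.sqrt (fine (S x)))) => n.
  have -> : g n.+1 x i 0 - g n x i 0 = (g n.+1 x - g n x) i 0 by rewrite !mxE.
  apply: le_trans (coord_le _ _) _.
  rewrite -(ler_pXn2r (n := 2)) ?nnegrE ?mulr_ge0 ?sqrtr_ge0 ?enorm_ge0 ?exprn_ge0//.
  have e4 : (2^-1 ^+ n) ^+ 2 = (4 ^+ n)^-1 :> R.
    by rewrite -exprM mulnC exprM -exprVn; congr (_ ^+ n); field.
  rewrite exprMn [Num.sqrt (fine _) ^+ 2]sqr_sqrtr ?fine_ge0// e4 ler_pdivlMr ?exprn_gt0// mulrC -lee_fin fineK//.
  apply: le_trans (nneseries_lim_ge (u_ := fun n => w n x) (P := xpredT) (m := 0) n.+1 _); last by [].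
  rewrite big_mkord big_ord_recr /= -[leLHS]add0e; apply: leeD => //.
  by apply: sume_ge0 => j _; exact: w0.
(* Multiplying by the indicator of [A] makes the sequence converge everywhere, so that its limit is
   measurable. *)
pose gA n x i : R := \1_A x * g n x i 0.
pose h x : 'cV[R]_d := \col_i limn (fun n => gA n x i).
have cvgh x i : gA ^~ x ^~ i @ \oo --> h x i 0.
  rewrite mxE; rewrite /gA indicE.
  have [/set_mem Ax|_] := boolP (x \in A).
    by under eq_fun do rewrite mul1r; exact: cvgA.
  by under eq_fun do rewrite mul0r; exact: is_cvg_cst.
have mh : measurable_fun [set: colv R d] (h : colv R d -> borel R d 1).
  apply: measurable_mxP => i j; rewrite (ord1 j).
  apply: (measurable_fun_cvg (h := fun n x => gA n x i)) => [n|x _]; last exact: cvgh.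
  apply: measurable_funM; first exact: measurable_indic.
  by case: (hg n) => mg _; exact: (measurableT_comp (@measurable_coord R d 1 i 0) mg).
(* Fatou's lemma in k, applied to the distances from g (k + n) to g n, which are bounded uniformly
   in k. *)
have key n : (\int[mu]_x (enorm (h x - g n x) ^+ 2)%:E <= ((2 * 4^-1 ^+ n) ^+ 2)%:E)%E.
  pose F k x : \bar R := (enorm (g (k + n)%N x - g n x) ^+ 2)%:E.
  have mF k : measurable_fun [set: colv R d] (F k).
    by apply/measurable_EFinP; apply: measurable_enorm2_comp; case: (sqintB (hg (k + n)%N) (hg n)).
  have F0 k x : (0 <= F k x)%E by rewrite lee_fin sqr_ge0.
  have einf_le (u : (\bar R)^nat) (c : \bar R) : (forall k, u k <= c)%E -> (limn_einf u <= c)%E.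
    move=> uc; rewrite limn_einf_lim; apply: lime_le; first exact: is_cvg_einfs.
    by apply: nearW => k; apply: le_trans (uc k); apply: ereal_inf_lbound; exists k => /=.
  apply: (@le_trans _ _ (\int[mu]_x limn_einf (F ^~ x))%E).
    apply: ae_ge0_le_integral => //.
    - by move=> x _; rewrite lee_fin sqr_ge0.
    - apply/measurable_EFinP; apply: measurable_enorm2_comp.
      have := measurable_lin (-1) (proj1 (hg n)) mh.
      by under eq_fun do rewrite scaleN1r addrC.
    - move=> x _; rewrite limn_einf_lim; apply: lime_ge; first exact: is_cvg_einfs.
      by apply: nearW => k; apply: le_ereal_inf_tmp => _ [j _ <-].
    - rewrite (_ : (fun x => _) = -%E \o (fun x => limn_esup (fun k => - F k x)%E)); last first.
        apply/funext => x /=; rewrite -limn_einfN.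
        by congr limn_einf; apply/funext => k; rewrite /F /= opprK.
      apply: (measurableT_comp (@oppe_measurable R setT)).
      by apply: measurable_fun_limn_esup => k; exact: (measurableT_comp (@oppe_measurable R setT) (mF k)).
    - apply: filterS aeA => x Ax _.
      have FE : F ^~ x @ \oo --> (enorm (h x - g n x) ^+ 2)%:E.
        apply: cvg_EFin; first by apply: nearW.
        rewrite enorm2_dot /comp /=; under eq_fun do rewrite enorm2_dot.
        rewrite /dot; apply: cvg_big => [|i _]; first exact: add_continuous.
        suff c1 : (g (k + n)%N x - g n x) i 0 @[k --> \oo] --> (h x - g n x) i 0 by apply: cvgM.
        have -> : (h x - g n x) i 0 = h x i 0 - g n x i 0 by rewrite !mxE.
        under eq_fun do rewrite mxE [X in _ + X]mxE.
        apply: cvgB; last exact: cvg_cst.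
        rewrite (cvg_shiftn n (fun k => g k x i 0)).
        have := cvgh x i; rewrite /gA indicE mem_set//.
        by under eq_fun do rewrite mul1r.
      by rewrite (cvg_limn_einf_sup FE).1.
  apply: le_trans (fatou mu measurableT mF _) _ => //.
  apply: einf_le => k.
  have hk := sqintB (hg (k + n)%N) (hg n).
  rewrite L2norm_EFin// lee_fin ler_pXn2r ?nnegrE ?L2norm_ge0 ?mulr_ge0 ?exprn_ge0//.
  apply: le_trans (L2norm_increments n k hg gc) _.
  by rewrite gerBl mulr_ge0 ?exprn_ge0.
exists h; last by move=> n; apply: L2norm_le; rewrite ?mulr_ge0 ?exprn_ge0.
have h0 : sqint mu (fun x => h x - g 0%N x).
  split; last by apply: le_lt_trans (key 0%N) _; rewrite ltry.
  have := measurable_lin (-1) (proj1 (hg 0%N)) mh.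
  by under eq_fun do rewrite scaleN1r addrC.
by have := sqintD h0 (hg 0%N); under eq_fun do rewrite subrK.
Qed.

End L2Complete.

(** * Laws, conditional expectations and Wasserstein bounds *)

Section Law.
Context {R : realType} {d : nat}.
Implicit Types (mu : P2 R d).

Definition mkL2 mu m n (g : colv R d -> borel R m n)
    (mg : measurable_fun [set: colv R d] g)
    (fg : (\int[mu]_x (enorm (g x) ^+ 2)%:E < +oo)%E) : L2maps mu m n :=
  @MkL2 R d mu m n (HB.pack g (isMeasurableFun.Build _ _ _ _ g mg)) fg.

Lemma L2_of mu (g : colv R d -> 'cV[R]_d) : sqint mu g ->
  exists Y : L2 mu, forall x, Y x = g x.
Proof. by case=> mg fg; exists (mkL2 mg fg). Qed.

Lemma law_fin mu (X : L2 mu) : (\int[distribution mu X]_x (enorm x ^+ 2)%:E < +oo)%E.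
Proof.
rewrite ge0_integral_distribution//; first exact: L2_fin.
- by apply/measurable_EFinP; exact: measurable_enorm2.
- by move=> x; rewrite lee_fin sqr_ge0.
Qed.

Definition law mu (X : L2 mu) : P2 R d := MkP2 (law_fin X).

Section OneLaw.
Variables (mu : P2 R d) (X : L2 mu).
Implicit Types (g v w : colv R d -> 'cV[R]_d).

Lemma measurable_comp_L2 g :
  measurable_fun [set: colv R d] (g : colv R d -> borel R d 1) ->
  measurable_fun [set: colv R d] ((fun x => g (X x)) : colv R d -> borel R d 1).
Proof. by move=> mg; exact: (measurableT_comp mg (proj1 (sqint_L2 X))). Qed.

Lemma integral_law_enorm g :
  measurable_fun [set: colv R d] (g : colv R d -> borel R d 1) ->
  (\int[law X]_x (enorm (g x) ^+ 2)%:E = \int[mu]_x (enorm (g (X x)) ^+ 2)%:E)%E.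
Proof.
move=> mg; rewrite ge0_integral_distribution//.
- by apply/measurable_EFinP; exact: measurable_enorm2_comp.
- by move=> x; rewrite lee_fin sqr_ge0.
Qed.

Lemma sqint_law g : sqint (law X) g -> sqint mu (fun x => g (X x)).
Proof.
by move=> [mg fg]; split; [exact: measurable_comp_L2|rewrite -integral_law_enorm].
Qed.

Lemma ip_law g v : sqint (law X) g -> sqint (law X) v ->
  ip (law X) g v = ip mu (fun x => g (X x)) (fun x => v (X x)).
Proof.
move=> hg hv; rewrite /ip /Rintegral integral_distribution//.
- by apply/measurable_EFinP; apply: measurable_dot; [case: hg|case: hv].
- exact: (sqint_dot (sqint_law hg) (sqint_law hv)).
Qed.

Lemma L2norm_law g : sqint (law X) g ->
  L2norm (law X) g = L2norm mu (fun x => g (X x)).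
Proof.
by move=> hg; apply/eqP; rewrite -(eqrXn2 (n := 2)) ?L2norm_ge0// !L2norm2 ip_law.
Qed.

Lemma L2norm2_parallelogram g v w : sqint mu g -> sqint mu v -> sqint mu w ->
  L2norm mu (fun x => v x - w x) ^+ 2 =
  2 * L2norm mu (fun x => g x - v x) ^+ 2 + 2 * L2norm mu (fun x => g x - w x) ^+ 2
  - 4 * L2norm mu (fun x => g x - (2^-1 *: v x + 2^-1 *: w x)) ^+ 2.
Proof.
move=> hg hv hw.
have h2 := sqintZ 2^-1 hw; have hl := sqint_lin 2^-1 hv h2.
have e1 : ip mu g (fun x => 2^-1 *: v x + 2^-1 *: w x) = 2^-1 * ip mu g v + 2^-1 * ip mu g w.
  by rewrite ipC (ip_linl 2^-1 hv h2 hg) (ipZl 2^-1 hw hg) (ipC mu v) (ipC mu w).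
have e2 : ip mu v (fun x => 2^-1 *: w x) = 2^-1 * ip mu v w.
  by rewrite ipC (ipZl 2^-1 hw hv) (ipC mu w).
have alg (s1 s2 s3 s4 s5 s6 g2 v2 w2 gv gw vw gl vh : R) :
    gl = 2^-1 * gv + 2^-1 * gw -> vh = 2^-1 * vw ->
    s1 = v2 - 2 * vw + w2 -> s2 = g2 - 2 * gv + v2 -> s3 = g2 - 2 * gw + w2 ->
    s4 = g2 - 2 * gl + s5 -> s5 = 2^-1 ^+ 2 * v2 + 2 * 2^-1 * vh + s6 ->
    s6 = 2^-1 ^+ 2 * w2 -> s1 = 2 * s2 + 2 * s3 - 4 * s4.
  by move=> -> -> -> -> -> -> -> ->; field.
apply: (alg _ _ _ _ _ _ _ _ _ _ _ _ _ _ e1 e2 (L2norm2B hv hw) (L2norm2B hg hv)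
  (L2norm2B hg hw) (L2norm2B hg hl) (L2norm2_lin 2^-1 hv h2)).
by rewrite (L2normZ 2^-1 hw) exprMn real_normK ?num_real.
Qed.

(* Orthogonal projection onto the closed subspace of the maps that factor
   through X, i.e. the conditional expectation given X. *)
Lemma projection_law g : sqint mu g ->
  exists2 p, sqint (law X) p & forall v, sqint (law X) v ->
    ip mu g (fun x => v (X x)) = ip (law X) p v.
Proof.
move=> hg.
pose J v := L2norm mu (fun x => g x - v (X x)) ^+ 2.
pose A := [set J v | v in sqint (law X)].
have Alb : has_inf A.
  split; first by exists (J (cst 0)), (cst 0) => //; exact: sqint_cst.
  by exists 0 => _ [v _ <-]; exact: sqr_ge0.
pose I := inf A.
have IJ v : sqint (law X) v -> I <= J v.
  by move=> hv; apply: ge_inf; [case: Alb|exists v].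
(* By the parallelogram identity, an excess of 16^-n / 4 over the infimum bounds the squared
   increments by (1/2 + 1/32) * 16^-n, which gives the rate 4^-n that [L2_complete] asks for. *)
have q0 n : 0 < 16^-1 ^+ n / 4 :> R by rewrite divr_gt0 ?exprn_gt0.
have approx n : exists2 v, sqint (law X) v & J v < I + 16^-1 ^+ n / 4.
  have [_ [v hv <-] Jv] := inf_adherent (q0 n) Alb.
  by exists v.
pose v n := sval (cid2 (approx n)).
have hv n : sqint (law X) (v n) by rewrite /v; case: cid2.
have Jv n : J (v n) < I + 16^-1 ^+ n / 4 by rewrite /v; case: cid2.
have vc n : L2norm (law X) (fun x => v n.+1 x - v n x) <= 4^-1 ^+ n.
  rewrite -(ler_pXn2r (n := 2)) ?nnegrE ?L2norm_ge0 ?exprn_ge0//.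
  rewrite L2norm_law; last exact: sqintB.
  have hm : sqint (law X) (fun x => 2^-1 *: v n.+1 x + 2^-1 *: v n x).
    by apply: sqint_lin => //; exact: sqintZ.
  have e16 : (4^-1 ^+ n) ^+ 2 = 16^-1 ^+ n :> R.
    by rewrite -exprM mulnC exprM; congr (_ ^+ n); field.
  have r0 : 0 < 16^-1 ^+ n :> R by rewrite exprn_gt0.
  have alg (r r' s a b m : R) : 0 < r -> r' = 16^-1 * r -> I <= m -> a < I + r' / 4 ->
      b < I + r / 4 -> s = 2 * a + 2 * b - 4 * m -> s <= r by lra.
  rewrite e16; apply: (alg _ _ _ _ _ _ r0 (exprS _ _) (IJ _ hm) (Jv n.+1) (Jv n)).
  exact: (L2norm2_parallelogram hg (sqint_law (hv n.+1)) (sqint_law (hv n))).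
have [p hp pv] := L2_complete hv vc.
exists p => //.
have Jp : J p <= I.
  apply/ler_addgt0Pr => e e0.
  have sJ n : Num.sqrt (J p) <= Num.sqrt (I + 16^-1 ^+ n / 4) + 2 * 4^-1 ^+ n.
    rewrite /J sqrtr_sqr ger0_norm ?L2norm_ge0//.
    apply: le_trans (L2norm_dist hg (sqint_law (hv n)) (sqint_law hp)) _.
    apply: lerD.
      rewrite -[leLHS]ger0_norm ?L2norm_ge0// -sqrtr_sqr ler_wsqrtr//.
      exact: ltW (Jv n).
    rewrite L2norm_sym -(L2norm_law (sqintB hp (hv n))).
    exact: pv.
  have I0 : 0 <= I by apply: lb_le_inf; [case: Alb|move=> _ [w _ <-]; exact: sqr_ge0].
  have c1 : (16^-1 ^+ n : R) @[n --> \oo] --> (0:R) by apply: cvg_expr; rewrite ger0_norm; lra.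
  have c2 : (4^-1 ^+ n : R) @[n --> \oo] --> (0:R) by apply: cvg_expr; rewrite ger0_norm; lra.
  have c4 : (I + 16^-1 ^+ n * 4^-1) @[n --> \oo] --> I + 0 * 4^-1.
    by apply: cvgD; [exact: cvg_cst|apply: cvgM => //; exact: cvg_cst].
  have c5 : Num.sqrt (I + 16^-1 ^+ n / 4) @[n --> \oo] --> Num.sqrt I.
    rewrite mul0r addr0 in c4.
    by apply: continuous_cvg; [exact: sqrt_continuous|exact: c4].
  have c3 : (Num.sqrt (I + 16^-1 ^+ n / 4) + 2 * 4^-1 ^+ n) @[n --> \oo] --> Num.sqrt I + 2 * 0.
    by apply: cvgD => //; apply: cvgM => //; exact: cvg_cst.
  rewrite mulr0 addr0 in c3.
  have : Num.sqrt (J p) <= Num.sqrt I.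
    rewrite -(cvg_lim _ c3)//; apply: limr_ge; first by apply: cvgP c3.
    by apply: nearW => n; exact: sJ.
  by rewrite ler_sqrt// => /le_trans; apply; rewrite lerDl ltW.
move=> w hw.
have hP := sqint_law hp; have hW := sqint_law hw.
have hr := sqintB hg hP.
rewrite ip_law//; apply/eqP; rewrite -subr_eq0 -ipBl//.
set r := (fun x => g x - p (X x)); set c := ip _ _ _.
have quad t : 0 <= t ^+ 2 * L2norm mu (fun x => w (X x)) ^+ 2 - 2 * t * c.
  have h1 : sqint (law X) (fun x => t *: w x + p x) by exact: sqint_lin.
  have := le_trans Jp (IJ _ h1); rewrite /J.
  have -> : (fun x => g x - (t *: w (X x) + p (X x))) = (fun x => (- t) *: w (X x) + r x).
    by apply/funext => x; rewrite /r scaleNr opprD addrCA.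
  have alg (s n2 r2 i : R) : s = (- t) ^+ 2 * n2 + 2 * (- t) * i + r2 -> r2 <= s ->
      0 <= t ^+ 2 * n2 - 2 * t * i by move=> ->; lra.
  have -> : c = ip mu (fun x => w (X x)) r by exact: ipC.
  exact: (alg _ _ _ _ (L2norm2_lin (- t) hW hr)).
set B := L2norm mu _ ^+ 2 in quad.
have B0 : 0 <= B by exact: sqr_ge0.
(* The minimizer of the quadratic is c / B; the denominator [B + 1] also covers [B = 0] and still
   makes the value negative unless [c = 0]. *)
have := quad (c / (B + 1)).
have -> : (c / (B + 1)) ^+ 2 * B - 2 * (c / (B + 1)) * c = - (c ^+ 2 * ((B + 2) / (B + 1) ^+ 2)).
  by field; rewrite lt0r_neq0// ltr_wpDl.
rewrite oppr_ge0 pmulr_lle0.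
  by move=> c0; rewrite -sqrf_eq0 eq_le c0 sqr_ge0.
by rewrite divr_gt0 ?exprn_gt0; lra.
Qed.

End OneLaw.

Lemma W2_ge0 mu nu : 0 <= W2 mu nu.
Proof. exact: sqrtr_ge0. Qed.

(** The joint law of (X, Y) is a coupling. Only the values of [m1] and [m2] on Borel sets are
    prescribed, so that the bound also applies to terms of [P2] that represent the law of X without
    being equal to [law X]. *)
Lemma W2_le mu (X Y : L2 mu) (m1 m2 : P2 R d) :
  (forall A : set (colv R d), measurable A -> m1 A = mu (X @^-1` A)) ->
  (forall A : set (colv R d), measurable A -> m2 A = mu (Y @^-1` A)) ->
  W2 m1 m2 <= L2norm mu (fun x => (X x : 'cV[R]_d) - Y x).
Proof.
move=> hX hY.
have mXY : measurable_fun [set: colv R d] (fun x => (X x, Y x) : colv R d * colv R d).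
  by apply: measurable_fun_pair; exact: measurable_funP.
pose XY : {mfun colv R d >-> (colv R d * colv R d)%type} :=
  HB.pack (fun x => (X x, Y x) : colv R d * colv R d) (isMeasurableFun.Build _ _ _ _ _ mXY).
have hsub := sqintB (sqint_L2 X) (sqint_L2 Y).
have cost : (\int[distribution mu XY]_z (enorm (z.1 - z.2 : 'cV[R]_d) ^+ 2)%:E =
    (L2norm mu (fun x => (X x : 'cV[R]_d) - Y x) ^+ 2)%:E)%E.
  rewrite ge0_integral_distribution ?L2norm_EFin//.
  - apply/measurable_EFinP; apply: (measurableT_comp (@measurable_enorm2 R d 1)).
    apply: measurable_mxP => i j.
    rewrite (_ : (fun x => _) = (fun z : colv R d * colv R d => (z.1 : borel R d 1) i j : R) \- (fun z => (z.2 : borel R d 1) i j : R)); last first.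
      by apply/funext => x; rewrite !mxE.
    by apply: measurable_funB; apply: (measurableT_comp (@measurable_coord R d 1 i j)).
  - by move=> x; rewrite lee_fin sqr_ge0.
rewrite /W2 -[leRHS]ger0_norm ?L2norm_ge0// -sqrtr_sqr ler_wsqrtr// -lee_fin.
set E := ereal_inf _.
have E0 : (0 <= E)%E.
  apply: le_ereal_inf_tmp => _ [pi _ <-]; apply: integral_ge0 => x _.
  by rewrite lee_fin sqr_ge0.
have EL : (E <= (L2norm mu (fun x => (X x : 'cV[R]_d) - Y x) ^+ 2)%:E)%E.
  rewrite -cost; apply: ereal_inf_lbound.
  exists (distribution mu XY) => // A mA.
  by split; [rewrite hX|rewrite hY].
by rewrite fineK// ge0_fin_numE// (le_lt_trans EL)// ltry.
Qed.

Lemma W2_law mu (X Y : L2 mu) : W2 (law X) (law Y) <= L2norm mu (fun x => (X x : 'cV[R]_d) - Y x).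
Proof. exact: W2_le. Qed.

End Law.

(** * Ekeland's variational principle *)

Section SmallPowers.
Context {R : realType}.

Lemma pow4_small (e : R) : 0 < e -> exists N, forall n, (N <= n)%N -> 4^-1 ^+ n < e.
Proof.
move=> e0.
have c : (4^-1 ^+ n : R) @[n --> \oo] --> (0 : R) by apply: cvg_expr; rewrite ger0_norm; lra.
have /cvgrPdist_lt /(_ e e0) [N _ NP] := c.
exists N => n Nn; have := NP n Nn.
by rewrite /= sub0r normrN ger0_norm// exprn_ge0.
Qed.

Lemma le_pow4 (x y c : R) : (forall n, x <= y + c * 4^-1 ^+ n) -> x <= y.
Proof.
move=> H; apply/ler_addgt0Pr => e e0.
have c0 : 0 < `|c| + 1 by rewrite ltr_wpDl.
have [N NP] := pow4_small (divr_gt0 e0 c0).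
apply: le_trans (H N) _; rewrite lerD2l.
have p0 : 0 <= 4^-1 ^+ N :> R by rewrite exprn_ge0.
apply: (@le_trans _ _ ((`|c| + 1) * 4^-1 ^+ N)).
  by apply: ler_wpM2r => //; rewrite (le_trans (ler_norm c))// lerDl.
by rewrite mulrC -ler_pdivlMr// ltW// NP.
Qed.

Lemma real_geometric_limit (t : nat -> R) :
  (forall n, `|t n - t n.+1| <= 4^-1 ^+ n) ->
  exists l, forall n, `|t n - l| <= 2 * 4^-1 ^+ n.
Proof.
move=> tc.
have ct : cvgn t.
  apply: (@cvgn_geometric_increments _ _ 1) => n; rewrite distrC mul1r.
  by apply: le_trans (tc n) _; apply: lerXn2r; rewrite ?nnegrE; lra.
have tk n k : `|t n - t (k + n)%N| <= 2 * 4^-1 ^+ n - 2 * 4^-1 ^+ (k + n).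
  elim: k => [|k IH]; first by rewrite add0n !subrr normr0.
  apply: le_trans (ler_distD (t (k + n)%N) _ _) _.
  apply: le_trans (lerD IH (tc _)) _; rewrite addSn exprS.
  have : 0 <= 4^-1 ^+ (k + n) :> R by rewrite exprn_ge0.
  by move: (4^-1 ^+ n) (4^-1 ^+ (k + n)) => a b; lra.
exists (limn t) => n; apply/ler_addgt0Pr => e e0.
have /cvgrPdist_lt /(_ e e0) [N _ NP] := ct.
have := NP (N + n)%N (leq_addr _ _); rewrite /= distrC => lN.
apply: le_trans (ler_distD (t (N + n)%N) _ _) _.
apply: lerD (ltW lN); apply: le_trans (tk n N) _.
by rewrite gerBl mulr_ge0 ?exprn_ge0.
Qed.

End SmallPowers.

Section Ekeland.
Context {R : realType} {Z : Type} (dist : Z -> Z -> R) (S : set Z) (F : Z -> R).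
Hypothesis dist_tri : forall x y z, dist x z <= dist x y + dist y z.
Hypothesis dist_xx : forall x, dist x x = 0.
Hypothesis dist_ge0 : forall x y, 0 <= dist x y.
Hypothesis complete : forall z : nat -> Z, (forall n, S (z n)) ->
  (forall n, dist (z n) (z n.+1) <= 4^-1 ^+ n) ->
  exists2 w, S w & exists c, forall n, dist (z n) w <= c * 4^-1 ^+ n.
Hypothesis F_usc : forall w, S w -> forall e, 0 < e -> exists2 del, 0 < del &
  forall y, S y -> dist y w < del -> F y < F w + e.
Variables (M : R) (eta : R).
Hypothesis F_le : forall z, S z -> F z <= M.
Hypothesis eta_gt0 : 0 < eta.

(** The relation y in T z, meaning that y beats z by eta times their distance, is transitive. Almost
    maximizing F over T (z n) with error eta * 4^-n forces the increments of the sequence below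
    4^-n, so it converges; upper semicontinuity puts its limit in every T (z n). *)
Lemma ekeland z0 : S z0 -> exists w, [/\ S w, F z0 + eta * dist z0 w <= F w &
  forall y, S y -> F y <= F w + eta * dist w y].
Proof.
move=> Sz0.
pose T z := [set y | S y /\ F z + eta * dist z y <= F y].
have Tz z : S z -> T z z by move=> Sz; split=> //; rewrite dist_xx mulr0 addr0.
have Ttr x y z : T x y -> T y z -> T x z.
  move=> [_ xy] [Sz yz]; split=> //; apply: le_trans yz; apply: le_trans (lerD xy (lexx _)).
  by rewrite -addrA -mulrDr lerD2l ler_pM2l.
have p4 n : 0 < eta * 4^-1 ^+ n by rewrite mulr_gt0 ?exprn_gt0.
have next_ex (n : nat) (z : {z | S z}) : exists y : {z | S z},
    T (sval z) (sval y) /\ forall x, T (sval z) x -> F x <= F (sval y) + eta * 4^-1 ^+ n.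
  have hs : has_sup (F @` T (sval z)).
    split; first by exists (F (sval z)), (sval z) => //; apply: Tz; exact: svalP.
    by exists M => _ [y [Sy _] <-]; exact: F_le.
  have [_ [y Ty <-] Fy] := sup_adherent (p4 n) hs.
  exists (exist _ y Ty.1); split=> // x Tx /=.
  by rewrite -lerBlDr ltW//; apply: le_lt_trans Fy; rewrite lerD2r; apply: ub_le_sup; [case: hs|exists x].
pose next n z := sval (cid (next_ex n z)).
have nextT n z : T (sval z) (sval (next n z)) by rewrite /next; case: cid => ? [].
have nextF n z x : T (sval z) x -> F x <= F (sval (next n z)) + eta * 4^-1 ^+ n.
  by rewrite /next; case: cid => ? [] ?; apply.
(* The sequence starts one step after [z0], so that [zF] already holds at n = 0: each [z n] almost
   maximizes F over the set T of its predecessor, which contains T (z n). *)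
pose zs := fix zs n := if n is m.+1 then next n (zs m) else next 0%N (exist _ z0 Sz0).
pose z n := sval (zs n).
have Sz n : S (z n) by exact: svalP.
have zF n x : T (z n) x -> F x <= F (z n) + eta * 4^-1 ^+ n.
  by case: n => [|n] Tx; apply: nextF; apply: Ttr Tx; exact: nextT.
have zT n k : T (z n) (z (k + n)%N).
  elim: k => [|k IH]; first exact: Tz.
  by apply: Ttr IH _; exact: nextT.
have zc n : dist (z n) (z n.+1) <= 4^-1 ^+ n.
  have T1 := zT n 1%N; have := le_trans T1.2 (zF _ _ T1).
  by rewrite lerD2l ler_pM2l.
have [w Sw [c wc]] := complete Sz zc.
have zw n : T (z n) w.
  split=> //; apply/ler_addgt0Pr => e e0.
  have [del del0 delP] := F_usc Sw (divr_gt0 e0 (ltr0n R 2)).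
  have c0 : 0 < `|c| + 1 by rewrite ltr_wpDl.
  have d0 : 0 < Num.min del (e / 2 / eta) / (`|c| + 1).
    by rewrite divr_gt0// lt_min del0 !divr_gt0.
  have [N NP] := pow4_small d0.
  have dN : dist (z (N + n)%N) w < Num.min del (e / 2 / eta).
    apply: le_lt_trans (wc _) _; have := NP (N + n)%N (leq_addr _ _).
    rewrite ltr_pdivlMr// mulrC; apply: le_lt_trans.
    by apply: ler_wpM2r; rewrite ?exprn_ge0// (le_trans (ler_norm c))// lerDl.
  move: dN; rewrite lt_min => /andP[d1 d2].
  have F1 := delP _ (Sz (N + n)%N) d1.
  have [_ F2] := zT n N.
  have F3 := dist_tri (z n) (z (N + n)%N) w.
  have F4 : eta * dist (z (N + n)%N) w <= e / 2 by rewrite mulrC -ler_pdivlMr// ltW.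
  have F5 : eta * dist (z n) w <= eta * dist (z n) (z (N + n)%N) + eta * dist (z (N + n)%N) w.
    by rewrite -mulrDr ler_pM2l.
  by lra.
exists w; split=> //.
  by have [] : T z0 w by apply: Ttr (zw 0%N); exact: (nextT 0%N (exist _ z0 Sz0)).
(* A point violating the conclusion lies in T w, hence in every T (z n), so F y exceeds F w by at
   most eta * 4^-n for all n. *)
move=> y Sy; rewrite leNgt; apply/negP => yw.
have Tw : T w y by split=> //; exact: ltW.
have : F y <= F w.
  apply: (@le_pow4 _ _ _ eta) => n; apply: le_trans (zF _ _ (Ttr _ _ _ (zw n) Tw)) _.
  rewrite lerD2r; have [_] := zw n; apply: le_trans; rewrite lerDl mulr_ge0 ?(ltW eta_gt0)//.

rewrite leNgt => /negP; apply; apply: le_lt_trans yw; rewrite lerDl mulr_ge0 ?(ltW eta_gt0)//.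
Qed.

End Ekeland.

(** * From random variables to epsilon-differentials *)

Section LawRegularity.
Context {R : realType} {d : nat}.
Implicit Types (mu : P2 R d).

Lemma sqint_id mu : sqint mu (fun x => x).
Proof. by split; [exact: measurable_id|exact: P2_fin]. Qed.

Lemma W2xx mu : W2 mu mu = 0.
Proof.
have [Y YE] := L2_of (sqint_id mu).
have YA (A : set (colv R d)) : mu A = mu (Y @^-1` A).
  by congr (mu _); apply/funext => x; rewrite /preimage /= YE.
apply/eqP; rewrite eq_le W2_ge0 andbT.
by rewrite -(L2norm0 mu Y); apply: W2_le => A _; exact: YA.
Qed.

Lemma varsigma_law mu (X : L2 mu) : varsigma (law X) = L2norm mu X.
Proof. by rewrite /varsigma L2norm_law//; exact: sqint_id. Qed.

Lemma sqrt_le (a b : R) : 0 <= b -> a <= b ^+ 2 -> Num.sqrt a <= b.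
Proof. by move=> b0 ab; rewrite -(ger0_norm b0) -sqrtr_sqr ler_wsqrtr. Qed.

Lemma tdist_le (t s : R) (m n : P2 R d) : tdist (t, m) (s, n) <= `|t - s| + W2 m n.
Proof.
have W0 := W2_ge0 m n; have a0 := normr_ge0 (t - s).
apply: sqrt_le; rewrite ?addr_ge0//=.
by rewrite sqrrD; move: (W2 m n) W0 a0 => w *; nra.
Qed.

Lemma tdist_law mu (X Y : L2 mu) (t s : R) :
  tdist (t, law X) (s, law Y) <= `|t - s| + L2norm mu (fun x => (X x : 'cV[R]_d) - Y x).
Proof. by apply: le_trans (tdist_le _ _ _ _) _; rewrite lerD2l W2_law. Qed.

(** The two measures agree on Borel sets and are therefore at distance 0, without being equal terms;
    continuity of [phi] identifies its values at them. *)
Lemma push_law mu (X Y : L2 mu) (T t h : R) (v : L2 (law X)) (phi : R * P2 R d -> R) :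
  continuous_on (@tdist R d) (tspace T) phi -> 0 <= t <= T ->
  (forall x, Y x = (X x : 'cV[R]_d) + h *: (v (X x) : 'cV[R]_d)) ->
  phi (t, push h v) = phi (t, law Y).
Proof.
move=> phic tT YE; apply/eqP; rewrite -subr_eq0 -normr_le0; apply/ler_addgt0Pr => e e0.
have [del del0 delP] := phic (t, push h v) tT e e0.
rewrite add0r ltW//; apply: delP => //.
apply: le_lt_trans (tdist_le _ _ _ _) _; rewrite subrr normr0 add0r.
apply: le_lt_trans del0; rewrite -(L2norm0 mu Y); apply: W2_le => A mA //.
by congr (mu _); apply/funext => x; rewrite /preimage /= YE.
Qed.

Lemma sqrt_sum_le (a b c e : R) :
  Num.sqrt ((a + b) ^+ 2 + (c + e) ^+ 2) <=
  Num.sqrt (a ^+ 2 + c ^+ 2) + Num.sqrt (b ^+ 2 + e ^+ 2).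
Proof.
have A0 := sqrtr_ge0 (a ^+ 2 + c ^+ 2); have B0 := sqrtr_ge0 (b ^+ 2 + e ^+ 2).
have A2 : Num.sqrt (a ^+ 2 + c ^+ 2) ^+ 2 = a ^+ 2 + c ^+ 2 by rewrite sqr_sqrtr ?addr_ge0 ?sqr_ge0.
have B2 : Num.sqrt (b ^+ 2 + e ^+ 2) ^+ 2 = b ^+ 2 + e ^+ 2 by rewrite sqr_sqrtr ?addr_ge0 ?sqr_ge0.
apply: sqrt_le; rewrite ?addr_ge0//.
move: (Num.sqrt _) A0 A2 (Num.sqrt _) B0 B2 => A A0 A2 B B0 B2.
have : (a * b + c * e) <= A * B.
  have [n|p] := leP (a * b + c * e) 0; first exact: le_trans n (mulr_ge0 A0 B0).
  rewrite -(ler_pXn2r (n := 2)) ?nnegrE ?mulr_ge0 ?(ltW p)// exprMn A2 B2.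
  by have := sqr_ge0 (a * e - c * b); nra.
by move=> ab; nra.
Qed.

Lemma tnorm_dist mu (theta theta' : R) (v w : colv R d -> 'cV[R]_d) :
  sqint mu v -> sqint mu w ->
  tnorm mu theta' w <= tnorm mu theta v + tnorm mu (theta' - theta) (fun x => w x - v x).
Proof.
move=> hv hw; apply: le_trans (sqrt_sum_le _ _ _ _).
rewrite /tnorm ler_wsqrtr// [theta + _]addrC subrK lerD2l ler_pXn2r ?nnegrE ?addr_ge0 ?L2norm_ge0//.
have := L2normD hv (sqintB hw hv).
by under [X in L2norm mu X <= _]eq_fun do rewrite addrC subrK.
Qed.

Lemma tnorm_ge mu (theta : R) (v : colv R d -> 'cV[R]_d) :
  `|theta| <= tnorm mu theta v /\ L2norm mu v <= tnorm mu theta v.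
Proof.
have L0 := L2norm_ge0 mu v; rewrite /tnorm; split.
  by rewrite -sqrtr_sqr ler_wsqrtr// lerDl sqr_ge0.
by rewrite -[leLHS]ger0_norm// -sqrtr_sqr ler_wsqrtr// lerDr sqr_ge0.
Qed.

Lemma shift_itv (T s y : R) : `|y| < s -> `|y| < T - s -> 0 <= s + y <= T.
Proof. by rewrite !ltr_norml => /andP[? ?] /andP[? ?]; apply/andP; split; lra. Qed.

Lemma quotient_bound (a h theta eps e p q i tn tn1 dd : R) :
  0 < h -> 0 <= eps -> tn1 <= tn + dd -> (eps + 1) * dd <= e -> 0 <= dd ->
  p <= q + a * (h * theta) + h * i + eps * (h * tn1) ->
  p - q - h * (a * theta + i) <= (eps * tn + e) * h.
Proof.
move=> h0 eps0 A1 A2 A3 A4.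
have A5 : eps * tn1 <= eps * tn + e.
  apply: le_trans (ler_wpM2l eps0 A1) _; rewrite mulrDr lerD2l.
  by apply: le_trans A2; rewrite ler_wpM2r// lerDl.
have A6 : h * (eps * tn1) <= h * (eps * tn + e) by rewrite ler_pM2l.
by lra.
Qed.

(* An upper tangent inequality at X in the space of random variables bounds the
   directional difference quotients of psi at law X. *)
Lemma tangent_quotient mu (X : L2 mu) (T s a eps r : R) (P : colv R d -> 'cV[R]_d)
    (psi : R * P2 R d -> R) (theta e : R) (v : L2 (law X)) :
  continuous_on (@tdist R d) (tspace T) psi -> 0 < s < T -> 0 < r -> 0 <= eps ->
  0 < e -> sqint mu P ->
  (forall t (Y : L2 mu), 0 <= t <= T -> `|t - s| < r ->
     L2norm mu (fun x => (Y x : 'cV[R]_d) - X x) < r ->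
     psi (t, law Y) <= psi (s, law X) + a * (t - s) + ip mu P (fun x => (Y x : 'cV[R]_d) - X x)
       + eps * tnorm mu (t - s) (fun x => (Y x : 'cV[R]_d) - X x)) ->
  exists2 del, 0 < del & forall z, dir_nbhs theta v del z ->
    z.1.1^-1 * (psi (s + z.1.1 * z.1.2, push z.1.1 z.2) - psi (s, law X)
      - z.1.1 * (a * z.1.2 + ip mu P (fun x => z.2 (X x)))) <=
    eps * tnorm (law X) theta v + e.
Proof.
move=> psic sT r0 eps0 e0 hP tang.
pose N := tnorm (law X) theta v + 1.
have N0 : 0 < N by rewrite ltr_wpDl// sqrtr_ge0.
pose rr := Num.min r (Num.min s (T - s)).
have rr0 : 0 < rr by rewrite !lt_min r0; case/andP: sT => -> ?; rewrite subr_gt0.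
have eps1 : 0 < eps + 1 by rewrite ltr_wpDl.
(* [e / (eps + 1)] absorbs the change of norm from (theta, v) to the nearby direction. As [N] bounds
   the norm of every nearby direction, [rr / N] keeps the displaced point in the ball where the
   tangent inequality holds and its time in [0, T]. *)
exists (Num.min 1 (Num.min (e / (eps + 1)) (rr / N))).
  by rewrite !lt_min ltr01 !divr_gt0.
move=> [[h theta'] w] [/= /andP[h0]]; rewrite !lt_min => /and3P[_ _ hr] /and3P[d1 de _].
have hv := sqint_L2 v; have hw := sqint_L2 w; have hX := sqint_L2 X.
have tri := tnorm_dist theta theta' hv hw.
have wN : tnorm (law X) theta' w < N by apply: le_lt_trans tri _; rewrite ltrD2l.
have [tN wN'] := tnorm_ge (law X) theta' w.
have hwX := sqint_law hw.
have hN : h * N < rr by rewrite -ltr_pdivlMr.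
have h1 : `|h * theta'| < rr.
  rewrite normrM (gtr0_norm h0); apply: le_lt_trans hN; rewrite ler_pM2l//.
  by rewrite (le_trans tN)// ltW.
have h2 : h * L2norm mu (fun x => w (X x)) < rr.
  rewrite -L2norm_law//; apply: le_lt_trans hN; rewrite ler_pM2l//.
  by rewrite (le_trans wN')// ltW.
have hY : sqint mu (fun x => h *: (w (X x) : 'cV[R]_d) + (X x : 'cV[R]_d)) by exact: sqint_lin.
have [Y YE] := L2_of hY.
have YX : (fun x => (Y x : 'cV[R]_d) - X x) = (fun x => h *: (w (X x) : 'cV[R]_d)).
  by apply/funext => x; rewrite YE addrK.
move: h1 h2; rewrite !lt_min => /and3P[h1r h1s h1T] /andP[h2r _].
have tT : 0 <= s + h * theta' <= T.
  exact: shift_itv.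
rewrite (push_law psic tT (Y := Y)); last by move=> x; rewrite YE addrC.
have := tang (s + h * theta') Y tT.
rewrite YX /tnorm L2normZ// (gtr0_norm h0) (addrC s) addrK => /(_ h1r h2r).
rewrite [ip mu P (fun x => _ *: _)]ipC (ipZl h hwX hP) (ipC mu _ P).
have -> : Num.sqrt ((h * theta') ^+ 2 + (h * L2norm mu (fun x => w (X x))) ^+ 2) =
    h * tnorm (law X) theta' w.
  rewrite /tnorm L2norm_law// -[in RHS](gtr0_norm h0) -sqrtr_sqr -sqrtrM ?sqr_ge0//.
  by congr Num.sqrt; move: (L2norm _ _) => c; ring.
set tn' := tnorm (law X) theta' w in tri wN *.
move=> H; rewrite mulrC ler_pdivrMr//.
have de' : (eps + 1) * tnorm (law X) (theta' - theta) (fun x => (w x : 'cV[R]_d) - v x) <= e.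
  by rewrite mulrC -ler_pdivlMr// ltW.
have dn0 : 0 <= tnorm (law X) (theta' - theta) (fun x => (w x : 'cV[R]_d) - v x) by exact: sqrtr_ge0.
exact: (quotient_bound h0 eps0 tri de' dn0 H).
Qed.

(** The functional [p] is the transposed conditional expectation of P given X, so pairing with any
    function of X is unchanged although P itself need not factor through X. *)
Lemma pairing_projection mu (X : L2 mu) (P : colv R d -> 'cV[R]_d) : sqint mu P ->
  exists p : L2star (law X), forall v : colv R d -> 'cV[R]_d, sqint (law X) v ->
    pairing (law X) p v = ip mu P (fun x => v (X x)).
Proof.
move=> hP; have [g hg gE] := projection_law X hP.
have et (x : colv R d) : enorm (g x)^T = enorm (g x).
  rewrite /enorm; congr Num.sqrt; rewrite exchange_big /=.
  by apply: eq_bigr => i _; apply: eq_bigr => j _; rewrite mxE.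
have mg : measurable_fun [set: colv R d] ((fun x => (g x)^T) : colv R d -> borel R 1 d).
  apply: measurable_mxP => i j; under eq_fun do rewrite mxE.
  exact: (measurableT_comp (@measurable_coord R d 1 j i) (proj1 hg)).
have fg : (\int[law X]_x (enorm ((g x)^T) ^+ 2)%:E < +oo)%E.
  by under eq_integral do rewrite et; exact: hg.2.
exists (mkL2 mg fg) => v hv; rewrite gE//.
apply: eq_Rintegral => x _; rewrite mxE; apply: eq_bigr => i _ /=.
by rewrite mxE.
Qed.

End LawRegularity.

(** * Regularity of the coefficients *)

Section Coefficients.
Context {R : realType} {d : nat} {U : metricType R}.
Variables (T : R) (f : R -> 'cV[R]_d -> P2 R d -> U -> 'cV[R]_d).
Variables (L : R -> P2 R d -> U -> R).
Implicit Types (mu : P2 R d).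

Lemma enorm_le_coord (x : 'cV[R]_d) (c : R) :
  (forall i, `|x i 0| <= c) -> 0 <= c -> enorm x <= d.+1%:R * c.
Proof.
move=> xc c0; rewrite -(ler_pXn2r (n := 2)) ?nnegrE ?enorm_ge0 ?mulr_ge0//.
rewrite enorm2_dot; apply: (@le_trans _ _ (\sum_(i < d) c ^+ 2)).
  apply: ler_sum => i _; rewrite -expr2 -real_normK ?num_real//.
  by rewrite ler_pXn2r ?nnegrE.
rewrite sumr_const card_ord -[_ *+ d]mulr_natl exprMn ler_wpM2r ?sqr_ge0//.
by rewrite -natrX ler_nat expnS expn1 mulSn addSn ltnW// ltnS leq_addr.
Qed.

Lemma lipschitz_measurable (g : 'cV[R]_d -> 'cV[R]_d) (K : R) : 0 <= K ->
  (forall x y, enorm (g x - g y) <= K * enorm (x - y)) ->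
  measurable_fun [set: colv R d] (g : colv R d -> borel R d 1).
Proof.
move=> K0 gK.
apply: (@measurability _ _ (colv R d) (borel R d 1) setT g (@open 'M[R]_(d, 1))) => //.
move=> _ [V oV <-]; rewrite setTI; apply: sub_sigma_algebra.
rewrite openE => x Vx.
have /nbhs_ballP[e /= e0 eV] : nbhs (g x : 'M[R]_(d, 1)) V by apply: open_nbhs_nbhs; split.
pose del := e / (K * d.+1%:R + 1).
have K1 : 0 < K * d.+1%:R + 1 by rewrite ltr_wpDl// mulr_ge0.
have del0 : 0 < del by rewrite divr_gt0.
apply/nbhs_ballP; exists del => // y [_ xy]; apply: eV; split=> // i j; rewrite (ord1 j).
have xyd : enorm (x - y) <= d.+1%:R * del.
  apply: enorm_le_coord; last exact: ltW.
  by move=> k; rewrite !mxE ltW//; exact: xy.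
rewrite /ball /=; have -> : g x i 0 - g y i 0 = (g x - g y) i 0 by rewrite !mxE.
apply: le_lt_trans (coord_le _ _) _; apply: le_lt_trans (gK _ _) _.
apply: le_lt_trans (ler_wpM2l K0 xyd) _.
by rewrite /del !mulrA ltr_pdivrMr// [ltLHS]mulrC ltr_pM2l// ltrDl.
Qed.

(** Squaring and (a + b)^2 <= 2 a^2 + 2 b^2 give integrability and the norm bound together; the
    resulting factor 2 reappears in the constants of [drift_diff]. *)
Lemma sqint_affine_bound mu (g k : colv R d -> 'cV[R]_d) (alpha beta : R) :
  measurable_fun [set: colv R d] (g : colv R d -> borel R d 1) -> sqint mu k ->
  0 <= alpha -> 0 <= beta -> (forall x, enorm (g x) <= alpha * enorm (k x) + beta) ->
  sqint mu g /\ L2norm mu g <= 2 * (alpha * L2norm mu k + beta).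
Proof.
move=> mg hk a0 b0 gk.
pose b := (fun x => 2 * alpha ^+ 2 * enorm (k x) ^+ 2 + 2 * beta ^+ 2) : colv R d -> R.
have gb x : enorm (g x) ^+ 2 <= b x.
  apply: (@le_trans _ _ ((alpha * enorm (k x) + beta) ^+ 2)).
    by rewrite ler_pXn2r ?nnegrE ?enorm_ge0 ?addr_ge0 ?mulr_ge0 ?enorm_ge0.
  rewrite /b; move: (enorm (k x)) => y.
  by have := sqr_ge0 (alpha * y - beta); nra.
have i1 : mu.-integrable [set: colv R d] (EFin \o (fun x => 2 * alpha ^+ 2 * enorm (k x) ^+ 2)).
  exact: (integrableZl measurableT (2 * alpha ^+ 2) (sqint_enorm2 hk)).
have i2 : mu.-integrable [set: colv R d] (EFin \o (fun=> 2 * beta ^+ 2)).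
  exact: (finite_measure_integrable_cst mu).
have ib : mu.-integrable [set: colv R d] (EFin \o b) by exact: (integrableD measurableT i1 i2).
have hg := sqint_le mg ib gb.
split=> //; have k0 := L2norm_ge0 mu k.
rewrite -(ler_pXn2r (n := 2)) ?nnegrE ?L2norm_ge0 ?mulr_ge0 ?addr_ge0 ?mulr_ge0//.
apply: (@le_trans _ _ (2 * alpha ^+ 2 * L2norm mu k ^+ 2 + 2 * beta ^+ 2)).
  rewrite {1}/L2norm sqr_sqrtr; last by apply: Rintegral_ge0 => x _; rewrite sqr_ge0.
  apply: (@le_trans _ _ (\int[mu]_x b x)).
    by apply: le_Rintegral => //; exact: sqint_enorm2.
  rewrite /b (RintegralD measurableT i1 i2) (RintegralZl _ measurableT (sqint_enorm2 hk)).
  rewrite Rintegral_cst// (_ : fine _ = 1) ?mulr1; last by have := @probability_setT _ _ _ mu => /(congr1 fine).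
  rewrite /L2norm sqr_sqrtr//; by apply: Rintegral_ge0 => x _; rewrite sqr_ge0.
move: (L2norm mu k) k0 => y y0.
by have := mulr_ge0 (mulr_ge0 a0 b0) y0; have := sqr_ge0 (alpha * y); have := sqr_ge0 beta; nra.
Qed.

Section Lipschitz.
Variables (K : R) (omega : R -> R).
Hypothesis K_ge0 : 0 <= K.
Hypothesis fK : forall s x y m n u, 0 <= s <= T ->
  enorm (f s x m u - f s y n u) <= K * (enorm (x - y) + W2 m n).
Hypothesis omega_ge0 : forall r, 0 <= r -> 0 <= omega r.
Hypothesis fomega : forall s r x m u, 0 <= s <= T -> 0 <= r <= T ->
  enorm (f s x m u - f r x m u) <= omega `|s - r| * (1 + enorm x + varsigma m).

Lemma measurable_drift s m u : 0 <= s <= T ->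
  measurable_fun [set: colv R d] ((fun x => f s x m u) : colv R d -> borel R d 1).
Proof.
move=> sT; apply: (@lipschitz_measurable (fun x => f s x m u) K) => // x y.
by apply: le_trans (fK _ _ _ _ _ sT) _; rewrite W2xx addr0.
Qed.

Lemma sqint_drift s m u mu : 0 <= s <= T -> sqint mu (fun x => f s x m u).
Proof.
move=> sT; have m1 := measurable_drift m u sT.
have hid := sqint_id mu.
have m0 : measurable_fun [set: colv R d] ((fun x => (-1) *: f s 0 m u + f s x m u) : colv R d -> borel R d 1).
  by apply: measurable_lin => //; exact: measurable_cst.
have hb x : enorm ((-1) *: f s 0 m u + f s x m u) <= K * enorm x + 0.
  rewrite scaleN1r addrC addr0; apply: le_trans (fK _ _ _ _ _ sT) _.
  by rewrite W2xx addr0 subr0.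
have [h _] := sqint_affine_bound m0 hid K_ge0 (lexx 0) hb.
have := sqintD h (sqint_cst mu (f s 0 m u)).
by under eq_fun do rewrite scaleN1r addrC addrA subrr add0r.
Qed.

(** Time is changed first, at the fixed X, and then the state together with its law. Since W2 of the
    laws is at most the L2 distance, both Lipschitz terms become multiples of |X - Y|. *)
Lemma drift_diff mu (X Y : L2 mu) t s u : 0 <= t <= T -> 0 <= s <= T ->
  L2norm mu (fun x => f t (X x) (law X) u - f s (Y x) (law Y) u) <=
  2 * omega `|t - s| * (1 + 2 * L2norm mu X) +
  4 * K * L2norm mu (fun x => (X x : 'cV[R]_d) - Y x).
Proof.
move=> tT sT.
have hX := sqint_L2 X; have hY := sqint_L2 Y; have hXY := sqintB hX hY.
have o0 : 0 <= omega `|t - s| by exact: omega_ge0.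
have f1 := sqint_law (sqint_drift (law X) u (law X) tT).
have f2 := sqint_law (sqint_drift (law X) u (law X) sT).
have f3 := sqint_law (sqint_drift (law Y) u (law Y) sT).
apply: le_trans (L2norm_dist f1 f2 f3) _; apply: lerD.
  have v0 : 0 <= varsigma (law X) by exact: L2norm_ge0.
  have hb x : enorm (f t (X x) (law X) u - f s (X x) (law X) u) <=
      omega `|t - s| * enorm (X x : 'cV[R]_d) + omega `|t - s| * (1 + varsigma (law X)).
    apply: le_trans (fomega _ _ _ tT sT) _.
    by move: (omega _) (enorm _) (varsigma _) => o a b; lra.
  have [_ H] := sqint_affine_bound (proj1 (sqintB f1 f2)) hX o0 (mulr_ge0 o0 (addr_ge0 ler01 v0)) hb.
  apply: le_trans H _; rewrite varsigma_law.
  by move: (omega _) (L2norm _ _) => o a; lra.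
have W := W2_law X Y; have W0 := W2_ge0 (law X) (law Y).
have hb x : enorm (f s (X x) (law X) u - f s (Y x) (law Y) u) <=
    K * enorm ((X x : 'cV[R]_d) - Y x) + K * W2 (law X) (law Y).
  by apply: le_trans (fK _ _ _ _ _ sT) _; rewrite mulrDr.
have [_ H] := sqint_affine_bound (proj1 (sqintB f2 f3)) hXY K_ge0 (mulr_ge0 K_ge0 W0) hb.
apply: le_trans H _.
move: (L2norm _ _) (W2 _ _) W W0 => a w wa w0.
by have := ler_wpM2l K_ge0 wa; lra.
Qed.

End Lipschitz.

Lemma modulus_small (omega : R -> R) : {within `[0, +oo[, continuous omega} ->
  omega 0 = 0 -> forall e, 0 < e ->
  exists2 del, 0 < del & forall r, 0 <= r -> r < del -> omega r < e.
Proof.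
move=> oc o0 e e0.
have oc1 : {within `[0, 1], continuous omega}.
  by apply: continuous_subspaceW oc => x /=; rewrite !in_itv /= andbT => /andP[].
have [_ /cvgrPdist_lt /(_ e e0) [del /= del0 delP] _] :=
  (proj1 (continuous_within_itvP omega ltr01) oc1).
exists del => // r; rewrite le_eqVlt => /predU1P[<-|r0] rdel; first by rewrite o0.
have := delP r; rewrite /= sub0r normrN (gtr0_norm r0) => /(_ rdel r0).
by rewrite o0 sub0r normrN; apply: le_lt_trans; exact: ler_norm.
Qed.

Lemma modulus_bounded (omega : R -> R) : 0 <= T -> {within `[0, +oo[, continuous omega} ->
  exists B, forall r, 0 <= r <= T -> omega r <= B.
Proof.
move=> T0 oc.
have oc1 : {within `[0, T], continuous omega}.
  by apply: continuous_subspaceW oc => x /=; rewrite !in_itv /= andbT => /andP[].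
have [c _ cP] := EVT_max T0 oc1.
by exists (omega c) => r rT; apply: cP; rewrite in_itv.
Qed.

(** With the measure frozen, the remaining arguments range over the compact set [0,T] x U. The
    near-covering form of compactness, along the filter of small positive del, turns pointwise
    continuity into one del for all (s, u). *)
Lemma running_cost_unif (hC1 : @C1 R U) (hC4 : C4 T L) (nu : P2 R d) (e : R) : 0 < e ->
  exists2 del, 0 < del & forall s r u, 0 <= s <= T -> 0 <= r <= T ->
    `|s - r| < del -> `|L s nu u - L r nu u| < e.
Proof.
move=> e0; have [_ cU] := hC1; have [Lc _] := hC4.
have cK : compact ([set` `[0, T]%R] `*` [set: U]).
  by apply: compact_setX => //; exact: segment_compact.
have /compact_near_coveringP nc := cK.
pose P (del : R) (x : R * U) := forall r, 0 <= r <= T -> `|x.1 - r| < del ->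
  0 <= x.1 <= T -> `|L x.1 nu x.2 - L r nu x.2| < e.
have [|del /= del0 delP] := nc R (0^'+) P _ _.
  move=> [s u] [/= sT _]; rewrite in_itv /= in sT.
  have [del del0 H] := Lc s nu u sT _ (divr_gt0 e0 (ltr0n R 2)).
  have d2 : 0 < del / 2 by rewrite divr_gt0.
  exists ((ball s (del / 2) `*` ball u del), [set x | x < del / 2]) => /=.
    split; last by apply: nbhs_right_lt.
    exists (ball s (del / 2), ball u del) => //=.
    by split; exact: nbhsx_ballx.
  move=> [[s' u'] del'] /= [[ss uu] dd] r rT sr sT'.
  have ss' : `|s - s'| < del / 2 by exact: ss.
  have uu' : mdist u u' < del by move: uu; rewrite ballEmdist.
  have A1 := H s' nu u' sT'; have A2 := H r nu u' rT.
  have h1 : `|L s nu u - L s' nu u'| < e / 2.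
    by apply: A1; rewrite ?W2xx//; lra.
  have h2 : `|L s nu u - L r nu u'| < e / 2.
    apply: A2; rewrite ?W2xx//.
    by apply: le_lt_trans (ler_distD s' _ _) _; lra.
  apply: le_lt_trans (ler_distD (L s nu u) _ _) _.
  by rewrite distrC; lra.
exists (del / 2); first by rewrite divr_gt0.
move=> s r u sT rT sr.
have dd : ball 0 del (del / 2).
  by rewrite /ball /= sub0r normrN ger0_norm; lra.
have := delP (del / 2) dd; rewrite /= divr_gt0// => /(_ isT (s, u)) H.
by apply: H => //=; split=> //; rewrite /= in_itv.
Qed.

End Coefficients.

(** * The viscosity inequalities in terms of tangents in L2(mu) *)

Section Lifting.
Context {R : realType} {d : nat} {U : metricType R}.
Variables (T : R) (f : R -> 'cV[R]_d -> P2 R d -> U -> 'cV[R]_d).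
Variables (L : R -> P2 R d -> U -> R).
Variable (mu : P2 R d).

(** A local one-sided expansion in Frechet form on the Hilbert space, in which P may be any random
    variable. Applied to [- phi] it also expresses lower tangents. *)
Definition upper_tangent (psi : R * P2 R d -> R) (s : R) (X : L2 mu) (a : R)
    (P : colv R d -> 'cV[R]_d) (eps : R) : Prop :=
  exists2 r, 0 < r & forall t (Y : L2 mu), 0 <= t <= T -> `|t - s| < r ->
     L2norm mu (fun x => (Y x : 'cV[R]_d) - X x) < r ->
     psi (t, law Y) <= psi (s, law X) + a * (t - s) + ip mu P (fun x => (Y x : 'cV[R]_d) - X x)
       + eps * tnorm mu (t - s) (fun x => (Y x : 'cV[R]_d) - X x).

Definition law_ball (X0 : L2 mu) (r : R) : set (P2 R d) :=
  [set law X | X in [set X : L2 mu | L2norm mu (fun x => (X x : 'cV[R]_d) - X0 x) <= r]].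

Lemma law_ball_bounded X0 r : dist_bounded (@W2 R d) (law_ball X0 r).
Proof.
exists (r + r) => _ _ [X /= Xr <-] [Y /= Yr <-].
apply: le_trans (W2_law _ _) _.
apply: le_trans (L2norm_dist (sqint_L2 X) (sqint_L2 X0) (sqint_L2 Y)) _.
by apply: lerD; [exact: Xr|rewrite (L2norm_sym mu X0 Y); exact: Yr].
Qed.

Variable (phi : R * P2 R d -> R).
Hypothesis hC3 : C3 T f.
Hypothesis phi_cont : continuous_on (@tdist R d) (tspace T) phi.

Lemma upper_tangent_superdiff s (X : L2 mu) a P eps (p : L2star (law X)) :
  0 < s < T -> 0 <= eps -> sqint mu P -> upper_tangent phi s X a P eps ->
  (forall v : colv R d -> 'cV[R]_d, sqint (law X) v ->
    pairing (law X) p v = ip mu P (fun x => v (X x))) ->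
  superdiff eps phi s (a, p).
Proof.
move=> sT eps0 hP [r r0 tang] pE theta v; apply/lee_addgt0Pr => e e0; rewrite -EFinD.
have [del del0 H] := tangent_quotient theta v phi_cont sT r0 eps0 e0 hP tang.
apply: ge_ereal_inf; eexists; first by exists del.
apply: ge_ereal_sup => _ [z zn <-]; rewrite lee_fin /diff_quot /= (pE _ (sqint_L2 z.2)).
exact: H.
Qed.

Lemma quotient_opp (h h' a th i p1 p2 n e : R) :
  h' * (- p1 - - p2 - h * (- a * th + -1 * i)) <= n + e ->
  - n - e <= h' * (p1 - p2 - h * (a * th + i)).
Proof.
have -> : h' * (- p1 - - p2 - h * (- a * th + -1 * i)) = - (h' * (p1 - p2 - h * (a * th + i))) by ring.
by move: (h' * _) => q; lra.
Qed.

Lemma lower_tangent_subdiff s (X : L2 mu) a P eps (p : L2star (law X)) :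
  0 < s < T -> 0 <= eps -> sqint mu P ->
  upper_tangent (fun z => - phi z) s X (- a) (fun x => (-1) *: P x) eps ->
  (forall v : colv R d -> 'cV[R]_d, sqint (law X) v ->
    pairing (law X) p v = ip mu P (fun x => v (X x))) ->
  subdiff eps phi s (a, p).
Proof.
move=> sT eps0 hP [r r0 tang] pE theta v; apply/lee_addgt0Pr => e e0.
have cN : continuous_on (@tdist R d) (tspace T) (fun z => - phi z).
  move=> x Sx e' e'0; have [del del0 H] := phi_cont Sx e'0; exists del => // y Sy xy.
  by rewrite -opprD normrN; exact: H.
have [del del0 H] := tangent_quotient theta v cN sT r0 eps0 e0 (sqintZ (-1) hP) tang.
rewrite -leeBlDr// -EFinB; apply: le_ereal_sup_tmp; eexists; first by exists del.
apply: le_ereal_inf_tmp => _ [z zn <-]; rewrite lee_fin /diff_quot /= (pE _ (sqint_L2 z.2)).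
have := H z zn; rewrite (ipZl _ hP (sqint_law (sqint_L2 z.2))).
exact: quotient_opp.
Qed.

(** The drift f(s, X, law X, u) is a function of X, so replacing P by its conditional expectation
    does not change its product with the drift. The bound holds for each u because the Hamiltonian
    is an infimum, and C depends only on the ball. *)
Lemma lifted_subsolution (X0 : L2 mu) (R1 : R) : strict_subsolution T f L phi ->
  exists2 C : R, 0 <= C & forall (s : R) (X : L2 mu) (a : R) P (eps : R) u, 0 < s < T ->
    L2norm mu (fun x => (X x : 'cV[R]_d) - X0 x) <= R1 -> 0 < eps -> sqint mu P ->
    upper_tangent phi s X a P eps ->
    - (C * eps) <= a + ip mu P (fun x => f s (X x) (law X) u) + L s (law X) u.
Proof.
move=> [_ sub]; have [C C0 H] := sub _ (law_ball_bounded X0 R1); exists C => //.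
move=> s X a P eps u sT XR eps0 hP tang.
have [p pE] := pairing_projection X hP.
have sp := upper_tangent_superdiff sT (ltW eps0) hP tang pE.
have lX : law_ball X0 R1 (law X) by exists X.
have := H s (law X) eps a p sT lX eps0 sp.
have [K K0 fK] := hC3.
have sT' : 0 <= s <= T by case/andP: sT => *; rewrite !ltW.
move=> /le_trans; rewrite -lee_fin -addrA EFinD; apply; apply: leeD => //.
apply: ereal_inf_lbound; exists u => //; congr EFin; congr (_ + _).
by rewrite -(pE (fun x => f s x (law X) u)); [|exact: (sqint_drift K0 fK _ _ _ sT')].
Qed.

(** The additional error [e] pays for an almost minimizing u, since the infimum in the Hamiltonian
    need not be known to be attained. *)
Lemma lifted_supersolution (X0 : L2 mu) (R1 : R) : strict_supersolution T f L phi ->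
  exists2 C : R, 0 <= C & forall (s : R) (X : L2 mu) (a : R) P (eps e : R), 0 < s < T ->
    L2norm mu (fun x => (X x : 'cV[R]_d) - X0 x) <= R1 -> 0 < eps -> 0 < e -> sqint mu P ->
    upper_tangent (fun z => - phi z) s X (- a) (fun x => (-1) *: P x) eps ->
    exists u, a + ip mu P (fun x => f s (X x) (law X) u) + L s (law X) u <= C * eps + e.
Proof.
move=> [_ sup]; have [C C0 H] := sup _ (law_ball_bounded X0 R1); exists C => //.
move=> s X a P eps e sT XR eps0 e0 hP tang.
have [p pE] := pairing_projection X hP.
have sp := lower_tangent_subdiff sT (ltW eps0) hP tang pE.
have lX : law_ball X0 R1 (law X) by exists X.
have := H s (law X) eps a p sT lX eps0 sp.
have [K K0 fK] := hC3.
have sT' : 0 <= s <= T by case/andP: sT => *; rewrite !ltW.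
rewrite addeC -leeBrDr// -EFinB => Hle.
have : (hamiltonian f L s p < (C * eps - a + e)%:E)%E.
  by apply: le_lt_trans Hle _; rewrite lte_fin ltrDl.
move=> /ereal_inf_lt [_ [u _ <-]]; rewrite lte_fin => Hu; exists u.
move: Hu; rewrite [X in X + _ < _](_ : _ = ip mu P (fun x => f s (X x) (law X) u)); last first.
  by rewrite -(pE (fun x => f s x (law X) u)); [|exact: (sqint_drift K0 fK _ _ _ sT')].
by move: (ip _ _ _) (L _ _ _) => *; lra.
Qed.

End Lifting.

(** * Boxes in the space of time-dependent random variables *)

Section PseudoMetricContinuity.
Context {R : realType} {Z : Type} (dist : Z -> Z -> R) (S : set Z).

Definition zcont (F : Z -> R) : Prop := forall w, S w -> forall e, 0 < e ->
  exists2 del, 0 < del & forall y, S y -> dist y w < del -> `|F y - F w| < e.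

Lemma zcont_lip (F : Z -> R) (c : R) : 0 <= c ->
  (forall y w, S y -> S w -> `|F y - F w| <= c * dist y w) -> zcont F.
Proof.
move=> c0 Fc w Sw e e0; have c1 : 0 < c + 1 by rewrite ltr_wpDl.
exists (e / (c + 1)); first by rewrite divr_gt0.
move=> y Sy yw; apply: le_lt_trans (Fc _ _ Sy Sw) _.
have [d0|d0] := leP (dist y w) 0; first exact: le_lt_trans (mulr_ge0_le0 c0 d0) e0.
move: yw; rewrite ltr_pdivlMr//; apply: le_lt_trans.
by rewrite mulrC ler_pM2l// lerDl.
Qed.

Lemma zcont_comp (F : Z -> R) (g : R -> R) : continuous g -> zcont F ->
  zcont (fun z => g (F z)).
Proof.
move=> gc Fc w Sw e e0.
have /cvgrPdist_lt /(_ e e0) /nbhs_ballP [del /= del0 delP] := gc (F w).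
have [del' del'0 H] := Fc w Sw del del0; exists del' => // y Sy yw.
rewrite distrC; apply: delP; rewrite /ball /= distrC; exact: H.
Qed.

Lemma zcontD (F G : Z -> R) : zcont F -> zcont G -> zcont (fun z => F z + G z).
Proof.
move=> Fc Gc w Sw e e0; have e2 : 0 < e / 2 by rewrite divr_gt0.
have [d1 d10 H1] := Fc w Sw _ e2; have [d2 d20 H2] := Gc w Sw _ e2.
exists (Num.min d1 d2); first by rewrite lt_min d10.
move=> y Sy; rewrite lt_min => /andP[y1 y2].
rewrite opprD addrACA; apply: le_lt_trans (ler_normD _ _) _.
by rewrite [e]splitr ltrD// ?H1 ?H2.
Qed.

Lemma zcontN (F : Z -> R) : zcont F -> zcont (fun z => - F z).
Proof. by move=> Fc; apply: (zcont_comp (g := -%R)) => //; exact: opp_continuous. Qed.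

Lemma zcontB (F G : Z -> R) : zcont F -> zcont G -> zcont (fun z => F z - G z).
Proof. by move=> Fc Gc; apply: zcontD => //; exact: zcontN. Qed.

Lemma zcontZ (F : Z -> R) c : zcont F -> zcont (fun z => c * F z).
Proof. by move=> Fc; apply: (zcont_comp (g := *%R c)) => //; exact: mulrl_continuous. Qed.

Lemma zcontX2 (F : Z -> R) : zcont F -> zcont (fun z => F z ^+ 2).
Proof. by move=> Fc; apply: (zcont_comp (g := fun x => x ^+ 2)) => //; exact: exprn_continuous. Qed.

Lemma zcont_max0 (F : Z -> R) : zcont F -> zcont (fun z => Num.max (F z) 0).
Proof.
move=> Fc; apply: (zcont_comp (g := fun x => Num.max x 0)) => // x.
by apply: continuous_max; [exact: cvg_id|exact: cvg_cst].
Qed.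

Lemma zcont_usc (F : Z -> R) : zcont F -> forall w, S w -> forall e, 0 < e ->
  exists2 del, 0 < del & forall y, S y -> dist y w < del -> F y < F w + e.
Proof.
move=> Fc w Sw e e0; have [del del0 H] := Fc w Sw e e0; exists del => // y Sy yw.
by rewrite -ltrBlDl; apply: le_lt_trans (H y Sy yw); exact: ler_norm.
Qed.

End PseudoMetricContinuity.

Section Boxes.
Context {R : realType} {d : nat} (mu : P2 R d).

Definition Ldist (X Y : L2 mu) : R := L2norm mu (fun x => (X x : 'cV[R]_d) - Y x).

Lemma Ldist_ge0 X Y : 0 <= Ldist X Y. Proof. exact: L2norm_ge0. Qed.
Lemma Ldist_xx X : Ldist X X = 0. Proof. exact: L2norm0. Qed.
Lemma Ldist_sym X Y : Ldist X Y = Ldist Y X. Proof. exact: L2norm_sym. Qed.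
Lemma Ldist_tri Y X Z : Ldist X Z <= Ldist X Y + Ldist Y Z.
Proof. exact: L2norm_dist (sqint_L2 X) (sqint_L2 Y) (sqint_L2 Z). Qed.

Lemma Ldist_lip X Y X' Y' : `|Ldist X Y - Ldist X' Y'| <= Ldist X X' + Ldist Y Y'.
Proof.
have A1 := Ldist_tri X' X Y; have A2 := Ldist_tri Y' X' Y.
have B1 := Ldist_tri X X' Y'; have B2 := Ldist_tri Y X Y'.
rewrite (Ldist_sym Y' Y) in A2; rewrite (Ldist_sym X' X) in B1.
move: A1 A2 B1 B2; move: (Ldist _ _) (Ldist _ _) (Ldist _ _) (Ldist _ _) (Ldist _ _) (Ldist _ _).
by move=> *; rewrite ler_norml; apply/andP; split; lra.
Qed.

Definition sdist (z w : R * L2 mu) : R := `|z.1 - w.1| + Ldist z.2 w.2.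

Lemma sdist_ge0 z w : 0 <= sdist z w.
Proof. by rewrite addr_ge0// Ldist_ge0. Qed.

Lemma sdist_xx z : sdist z z = 0.
Proof. by rewrite /sdist subrr normr0 add0r Ldist_xx. Qed.

Lemma sdist_tri z w v : sdist z v <= sdist z w + sdist w v.
Proof. by rewrite /sdist addrACA lerD// ?ler_distD ?Ldist_tri. Qed.

Definition box (hi : R) (X0 : L2 mu) (r : R) : set (R * L2 mu) :=
  [set z | 0 <= z.1 <= hi /\ Ldist z.2 X0 <= r].

Lemma box_complete hi X0 r (z : nat -> R * L2 mu) :
  (forall n, box hi X0 r (z n)) ->
  (forall n, sdist (z n) (z n.+1) <= 4^-1 ^+ n) ->
  exists2 w, box hi X0 r w & forall n, sdist (z n) w <= 4 * 4^-1 ^+ n.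
Proof.
move=> bz zc.
have tc n : `|(z n).1 - (z n.+1).1| <= 4^-1 ^+ n.
  by apply: le_trans (zc n); rewrite lerDl Ldist_ge0.
have Xc n : L2norm mu (fun x => ((z n.+1).2 x : 'cV[R]_d) - (z n).2 x) <= 4^-1 ^+ n.
  by apply: le_trans (zc n); rewrite -/(Ldist _ _) Ldist_sym lerDr.
have [t tP] := real_geometric_limit tc.
have [h hh hP] := L2_complete (fun n => sqint_L2 (z n).2) Xc.
have [Y YE] := L2_of hh.
have YP n : Ldist (z n).2 Y <= 2 * 4^-1 ^+ n.
  rewrite Ldist_sym; apply: le_trans (hP n); rewrite /Ldist.
  by under eq_fun do rewrite YE.
exists (t, Y).
  split=> /=.
    apply/andP; split.
      apply: (@le_pow4 _ _ _ 2) => n; have [/andP[z0 _] _] := bz n.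
      by have := tP n; rewrite ler_norml => /andP[_]; move: (_ ^+ n) z0 => a; lra.
    apply: (@le_pow4 _ _ _ 2) => n; have [/andP[_ z1] _] := bz n.
    by have := tP n; rewrite ler_norml => /andP[+ _]; move: (_ ^+ n) z1 => a; lra.
  apply: (@le_pow4 _ _ _ 2) => n; have [_ zr] := bz n.
  apply: le_trans (Ldist_tri (z n).2 _ _) _; rewrite addrC lerD// Ldist_sym.
  exact: YP.
move=> n; have := lerD (tP n) (YP n); rewrite /sdist /=.
by move: (_ + _) (_ ^+ n) => a b; lra.
Qed.

Definition zdist (z w : (R * L2 mu) * (R * L2 mu)) : R :=
  sdist z.1 w.1 + sdist z.2 w.2.

Lemma zdist_ge0 z w : 0 <= zdist z w.
Proof. by rewrite addr_ge0 ?sdist_ge0. Qed.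

Lemma zdist_xx z : zdist z z = 0.
Proof. by rewrite /zdist !sdist_xx addr0. Qed.

Lemma zdist_tri z w v : zdist z v <= zdist z w + zdist w v.
Proof.
apply: le_trans (lerD (sdist_tri z.1 w.1 v.1) (sdist_tri z.2 w.2 v.2)) _.
by rewrite /zdist; move: (sdist z.1 _) (sdist w.1 _) (sdist z.2 _) (sdist w.2 _) => *; rewrite [leLHS]addrACA.
Qed.

Lemma boxes_complete hi1 hi2 X0 r1 r2 (z : nat -> (R * L2 mu) * (R * L2 mu)) :
  (forall n, (box hi1 X0 r1 `*` box hi2 X0 r2) (z n)) ->
  (forall n, zdist (z n) (z n.+1) <= 4^-1 ^+ n) ->
  exists2 w, (box hi1 X0 r1 `*` box hi2 X0 r2) w &
    exists c, forall n, zdist (z n) w <= c * 4^-1 ^+ n.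
Proof.
move=> bz zc.
have c1 n : sdist (z n).1 (z n.+1).1 <= 4^-1 ^+ n.
  by apply: le_trans (zc n); rewrite lerDl sdist_ge0.
have c2 n : sdist (z n).2 (z n.+1).2 <= 4^-1 ^+ n.
  by apply: le_trans (zc n); rewrite lerDr sdist_ge0.
have [w1 b1 w1P] := box_complete (fun n => proj1 (bz n)) c1.
have [w2 b2 w2P] := box_complete (fun n => proj2 (bz n)) c2.
exists (w1, w2) => //; exists 8 => n; have := lerD (w1P n) (w2P n).
by rewrite /zdist /=; move: (_ + _) (_ ^+ n) => a b; lra.
Qed.

Lemma phi_zcont (T hi : R) X0 r (phi : R * P2 R d -> R) : hi <= T ->
  continuous_on (@tdist R d) (tspace T) phi ->
  zcont sdist (box hi X0 r) (fun z => phi (z.1, law z.2)).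
Proof.
move=> hT pc [t X] [/= /andP[t0 th] _] e e0.
have [|del del0 H] := pc (t, law X) _ e e0.
  by rewrite /tspace /= t0 (le_trans th hT).
exists del => // -[s Y] [/= /andP[s0 sh] _] yw.
rewrite distrC; apply: H; first by rewrite /tspace /= s0 (le_trans sh hT).
apply: le_lt_trans (tdist_law _ _ _ _) _; apply: le_lt_trans yw.
by rewrite /sdist /= distrC -/(Ldist X Y) Ldist_sym.
Qed.

Lemma tdist_box_bounded hi X0 r :
  dist_bounded (@tdist R d) [set (z.1, law z.2) | z in box hi X0 r].
Proof.
exists (hi + (r + r)) => _ _ [z [/= /andP[z0 zh] zr] <-] [w [/= /andP[w0 wh] wr] <-].
apply: le_trans (tdist_law _ _ _ _) _; apply: lerD.
  by rewrite ler_norml; apply/andP; split; lra.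
apply: le_trans (Ldist_tri X0 _ _) _; rewrite (Ldist_sym X0); exact: lerD.
Qed.

Lemma box_tspace (T hi : R) X0 r : hi <= T ->
  [set (z.1, law z.2) | z in box hi X0 r] `<=` tspace T.
Proof.
by move=> hT _ [z [/= /andP[z0 zh] zr] <-]; rewrite /tspace /= z0 (le_trans zh).
Qed.

Lemma UC_box (T : R) X0 r (phi : R * P2 R d -> R) : UC (@tdist R d) (tspace T) phi ->
  forall e, 0 < e -> exists2 del, 0 < del & forall z w, box T X0 r z -> box T X0 r w ->
    sdist z w < del -> `|phi (z.1, law z.2) - phi (w.1, law w.2)| < e.
Proof.
move=> puc e e0.
have [del del0 H] := puc _ (@box_tspace T T X0 r (lexx _)) (tdist_box_bounded T X0 r) e e0.
exists del => // z w bz bw zw; apply: H; [by exists z|by exists w|].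
by apply: le_lt_trans zw; exact: tdist_law.
Qed.

Lemma tnorm_le_add (theta : R) (v : colv R d -> 'cV[R]_d) :
  tnorm mu theta v <= `|theta| + L2norm mu v.
Proof.
have a0 := normr_ge0 theta; have n0 := L2norm_ge0 mu v.
apply: sqrt_le; rewrite ?addr_ge0// -[theta ^+ 2]real_normK ?num_real//.
by move: (L2norm mu v) n0 => n *; nra.
Qed.

Lemma L2norm_le_add (g k : colv R d -> 'cV[R]_d) : sqint mu g -> sqint mu k ->
  L2norm mu g <= L2norm mu (fun x => g x - k x) + L2norm mu k.
Proof.
move=> hg hk; have := L2normD (sqintB hg hk) hk.
by under [X in L2norm mu X <= _]eq_fun do rewrite subrK.
Qed.

End Boxes.

Arguments sdist {R d mu}.
Arguments zdist {R d mu}.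

(** * Linear growth of the drift *)

Section DriftBound.
Context {R : realType} {d : nat} {U : metricType R}.
Variables (T : R) (f : R -> 'cV[R]_d -> P2 R d -> U -> 'cV[R]_d).
Variables (L : R -> P2 R d -> U -> R).

(** Dividing by kappa and letting kappa grow gives n^2 <= c n. If n exceeded c, the explicit kappa =
    (|a| + 1) / (n (n - c)) would already contradict the inequality. *)
Lemma quadratic_growth_bound (n c a : R) : 0 <= c -> 0 <= n ->
  (forall kappa, 0 < kappa -> kappa * n ^+ 2 <= a + c * kappa * n) -> n <= c.
Proof.
move=> c0 n0 H; rewrite leNgt; apply/negP => cn.
have np : 0 < n by exact: le_lt_trans cn.
have p : 0 < n * (n - c) by rewrite mulr_gt0// subr_gt0.
have k0 : 0 < (`|a| + 1) / (n * (n - c)) by rewrite divr_gt0// ltr_wpDl.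
have := H _ k0; set k := _ / _ in k0 *.
have kE : k * (n * (n - c)) = `|a| + 1 by rewrite /k divfK// lt0r_neq0.
have := ler_norm a.
have -> : k * n ^+ 2 = k * (n * (n - c)) + c * k * n by ring.
by rewrite kE; lra.
Qed.

Lemma affine_growth (C B K o e n m : R) : 0 <= C -> 0 <= B -> 0 <= K -> 0 <= n -> 0 <= m ->
  o <= B -> e <= n + m ->
  2 * o * (1 + 2 * n) + 4 * K * e + C <= (C + 4 * B + 4 * K + 4 * K * m + 1) * (1 + n).
Proof.
move=> C0 B0 K0 n0 m0 oB eX.
have A1 : o * (1 + 2 * n) <= B * (1 + 2 * n) by rewrite ler_wpM2r// addr_ge0 ?mulr_ge0.
have A2 : K * e <= K * (n + m) by exact: ler_wpM2l.
have A3 := mulr_ge0 C0 n0; have A4 := mulr_ge0 (mulr_ge0 K0 m0) n0.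
have A5 := mulr_ge0 B0 n0; have A6 := mulr_ge0 K0 n0.
by lra.
Qed.

(* C1--C5 do not bound f in u; the strict subsolution inequality does, because
   it holds for all eps, however large: once some eps-superdifferential
   contains (0, 0), the (eps + kappa |W|)-one contains (0, kappa W), and the
   bound on |f| comes from W = - f and kappa -> oo. *)
Lemma drift_bounded (mu : P2 R d) (phi : R * P2 R d -> R) :
  0 < T -> C2 T f -> C3 T f ->
  continuous_on (@tdist R d) (tspace T) phi -> strict_subsolution T f L phi ->
  exists2 c0 : R, 0 < c0 & forall (s : R) (X : L2 mu) u, 0 <= s <= T ->
    L2norm mu (fun x => f s (X x) (law X) u) <= c0 * (1 + L2norm mu X).
Proof.
move=> T0 [omega [oc o0 o00 fo]] hC3 pc psub.
have [K K0 fK] := hC3.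
have [X0 _] := L2_of (sqint_id mu).
have [C C0 HC] := lifted_subsolution hC3 pc X0 1 psub.
have [M MP] := psub.1.2 _ (@box_tspace _ _ _ T T X0 1 (lexx _)) (tdist_box_bounded T X0 1).
pose F (z : R * L2 mu) := phi (z.1, law z.2).
have Fc : zcont sdist (box T X0 1) F by exact: phi_zcont.
pose z0 := (T / 2, X0).
have T2 : 0 <= T / 2 <= T by apply/andP; split; lra.
have Sz0 : box T X0 1 z0 by split; rewrite //= Ldist_xx.
have FM z : box T X0 1 z -> F z <= M by move=> bz; apply: MP; exists z.
pose b := Num.min 1 (T / 2).
have b0 : 0 < b by rewrite lt_min ltr01 divr_gt0.
(* This slope is so steep that an Ekeland point started at [z0] stays within [b] of it, hence in the
   interior of the box. Its size is harmless, as the strict inequality holds for every eps. *)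
pose eta := (`|M - F z0| + 1) / b.
have eta0 : 0 < eta by rewrite divr_gt0// ltr_wpDl.
have cplt (z : nat -> R * L2 mu) : (forall n, box T X0 1 (z n)) ->
    (forall n, sdist (z n) (z n.+1) <= 4^-1 ^+ n) ->
    exists2 w, box T X0 1 w & exists c, forall n, sdist (z n) w <= c * 4^-1 ^+ n.
  by move=> bz zc; have [w bw wP] := box_complete bz zc; exists w => //; exists 4.
have [[tb Xb] [Sw w1 w2]] := ekeland (@sdist_tri _ _ mu) (@sdist_xx _ _ mu)
  (@sdist_ge0 _ _ mu) cplt (zcont_usc Fc) FM eta0 Sz0.
have db : sdist z0 (tb, Xb) < b.
  rewrite -(ltr_pM2l eta0) {2}/eta divfK ?lt0r_neq0//.
  have := FM _ Sw; have := ler_norm (M - F z0).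
  by move: w1; move: (eta * _) (F _) (F _) `|_| => *; lra.
have db1 : `|T / 2 - tb| < b.
  by apply: le_lt_trans db; rewrite /sdist /= lerDl Ldist_ge0.
have db2 : Ldist Xb X0 < b.
  by apply: le_lt_trans db; rewrite /sdist /= Ldist_sym lerDr.
have tbT : 0 < tb < T.
  move: db1; rewrite lt_min => /andP[_]; rewrite ltr_norml => /andP[h1 h2].
  by move: h1 h2; clear; move=> *; apply/andP; split; lra.
have Xb1 : Ldist Xb X0 < 1 by move: db2; rewrite lt_min => /andP[].
have tbT' : 0 <= tb <= T by case/andP: tbT => *; rewrite !ltW.
have fbase u : L2norm mu (fun x => f tb (Xb x) (law Xb) u) <= C.
  set g := (fun x => f tb (Xb x) (law Xb) u).
  have hg : sqint mu g by exact: (sqint_law (sqint_drift K0 fK (law Xb) u (law Xb) tbT')).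
  apply: (@quadratic_growth_bound _ _ (L tb (law Xb) u + 2 * C * eta)).
  - exact: C0.
  - exact: L2norm_ge0.
  move=> kappa k0.
  have gn0 := L2norm_ge0 mu g.
  have eps0 : 0 < 2 * eta + kappa * L2norm mu g 
    by apply: ltr_pwDl; [exact: mulr_gt0|exact: mulr_ge0 (ltW k0) gn0].
  have hP := sqintZ (- kappa) hg.
  have := HC tb Xb 0 (fun x => (- kappa) *: g x) _ u tbT (ltW Xb1) eps0 hP.
  rewrite (ipZl _ hg hg) -L2norm2 => H.
  (* The term [2 * eta] arises because [sdist] is a sum of two parts, each at most the norm [tnorm];
     Cauchy-Schwarz accounts for the other term. *)
  have tang : upper_tangent T phi tb Xb 0 (fun x => - kappa *: g x) (2 * eta + kappa * L2norm mu g).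
    exists (1 - Ldist Xb X0); first by rewrite subr_gt0.
    move=> t Y tT _ YX.
    have SY : box T X0 1 (t, Y).
      split; first exact: tT.
      apply: le_trans (Ldist_tri Xb _ _) _.
      by rewrite -lerBrDr; exact: ltW.
    have := w2 _ SY; rewrite /F /sdist /= => ineq.
    have hYX := sqintB (sqint_L2 Y) (sqint_L2 Xb).
    have [n1 n2] := tnorm_ge mu (t - tb) (fun x => (Y x : 'cV[R]_d) - Xb x).
    have := cauchy_schwarz hg hYX; rewrite ler_norml => /andP[_ cs].
    rewrite (ipZl _ hg hYX) mul0r addr0.
    rewrite distrC (Ldist_sym Xb) in ineq.
    have kc := ler_wpM2l (ltW k0) cs.
    have kn : kappa * (L2norm mu g * Ldist Y Xb) <= kappa * (L2norm mu g * tnorm mu (t - tb) (fun x => (Y x : 'cV[R]_d) - Xb x)).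
      by rewrite ler_pM2l// ler_wpM2l.
    have e1 := ler_wpM2l (ltW eta0) n1; have e2 := ler_wpM2l (ltW eta0) n2.
    move: ineq kc kn e1 e2; rewrite /Ldist.
    move: (L2norm mu (fun x => (Y x : 'cV[R]_d) - Xb x)) (ip _ _ _) (tnorm _ _ _) (phi _) (phi _) `|_| (L2norm mu g).
    by clear; move=> *; lra.
  have := H tang; move: (L2norm mu g) (L _ _ _); clear.
  by move=> *; lra.
(* The bound at the single point (tb, Xb), uniform in u, spreads to all times and states through the
   modulus and the Lipschitz constant of f. *)
have [B BP] := modulus_bounded (ltW T0) oc.
have B0 : 0 <= B by apply: le_trans (BP 0 _); [exact: o0|rewrite lexx ltW].
have N0 := L2norm_ge0 mu Xb.
exists (C + 4 * B + 4 * K + 4 * K * L2norm mu Xb + 1).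
  by rewrite ltr_wpDl// !addr_ge0// !mulr_ge0.
move=> s X u sT.
have h1 := sqint_law (sqint_drift K0 fK (law X) u (law X) sT).
have h2 := sqint_law (sqint_drift K0 fK (law Xb) u (law Xb) tbT').
apply: le_trans (L2norm_le_add h1 h2) _.
apply: le_trans (lerD (drift_diff K0 fK o0 fo X Xb u sT tbT') (fbase u)) _.
have oB : omega `|s - tb| <= B.
  apply: BP; rewrite normr_ge0 /= ler_norml.
  by case/andP: sT => ? ?; case/andP: tbT' => ? ?; apply/andP; split; lra.
have XX : L2norm mu (fun x => (X x : 'cV[R]_d) - Xb x) <= L2norm mu X + L2norm mu Xb.
  rewrite (_ : (fun x => _) = (fun x => (X x : 'cV[R]_d) + (-1) *: (Xb x : 'cV[R]_d))); last first.
    by apply/funext => x; rewrite scaleN1r.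
  have := L2normD (sqint_L2 X) (sqintZ (-1) (sqint_L2 Xb)).
  by rewrite (L2normZ _ (sqint_L2 Xb)) normrN1 mul1r.
have n0 := L2norm_ge0 mu X.
have o1 : 0 <= omega `|s - tb| by exact: o0.
exact: affine_growth.
Qed.

End DriftBound.

(** * Doubling of variables *)

Section PenalizedTangents.
Context {R : realType} {d : nat}.
Variables (T : R) (mu : P2 R d) (phi1 phi2 : R * P2 R d -> R).
Variables (X0 Yh : L2 mu) (t0 t1 R0 m A lam alpha beta eta : R).
Hypotheses (t1T : t1 <= T) (R0_gt0 : 0 < R0) (m_ge0 : 0 <= m) (A_ge0 : 0 <= A).
Hypotheses (alpha_ge0 : 0 <= alpha) (beta_ge0 : 0 <= beta) (eta_gt0 : 0 < eta).

(** A squared distance, not a distance, so that it is smooth at X0; [max (cone, 0) ^ 2] is then a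
    penalty with Lipschitz derivative in the cone variable that vanishes inside the cone. *)
Definition cone (z : R * L2 mu) : R := Ldist z.2 X0 ^+ 2 - m * (z.1 - t0).

(** Only the first point carries the cone and the term in [lam]. The latter makes the subsolution
    inequality strict by [lam], which all errors must finally fail to reach. *)
Definition doubled (z : (R * L2 mu) * (R * L2 mu)) : R :=
  phi1 (z.1.1, law z.1.2) - phi2 (z.2.1, law z.2.2) - alpha * Ldist z.1.2 z.2.2 ^+ 2
  - A * Num.max (cone z.1) 0 ^+ 2 - lam * (t1 - z.1.1).

(** Separate from [doubled] because [Yh] is obtained by almost maximizing [doubled] on equal times,
    before [beta] is known. The last term anchors the second point at [Yh]. *)
Definition penalized (z : (R * L2 mu) * (R * L2 mu)) : R :=
  doubled z - beta * (z.1.1 - z.2.1) ^+ 2 - 2 * eta * Ldist z.2.2 Yh.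

Lemma zcont_fst (B1 B2 : set (R * L2 mu)) (F : R * L2 mu -> R) : zcont sdist B1 F ->
  zcont zdist (B1 `*` B2) (fun z => F z.1).
Proof.
move=> Fc w [Sw _] e e0; have [del del0 H] := Fc _ Sw e e0; exists del => // y [Sy _] yw.
by apply: H => //; apply: le_lt_trans yw; rewrite lerDl sdist_ge0.
Qed.

Lemma zcont_snd (B1 B2 : set (R * L2 mu)) (F : R * L2 mu -> R) : zcont sdist B2 F ->
  zcont zdist (B1 `*` B2) (fun z => F z.2).
Proof.
move=> Fc w [_ Sw] e e0; have [del del0 H] := Fc _ Sw e e0; exists del => // y [_ Sy] yw.
by apply: H => //; apply: le_lt_trans yw; rewrite lerDr sdist_ge0.
Qed.

Lemma zcont_time (B : set (R * L2 mu)) : zcont sdist B (fun z : R * L2 mu => z.1).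
Proof.
apply: (zcont_lip ler01) => y w _ _; rewrite mul1r /sdist lerDl; exact: Ldist_ge0.
Qed.

Lemma zcont_dist (B : set (R * L2 mu)) (Y : L2 mu) : zcont sdist B (fun z : R * L2 mu => Ldist z.2 Y).
Proof.
apply: (zcont_lip ler01) => y w _ _; rewrite mul1r /sdist.
apply: le_trans (Ldist_lip _ _ _ _) _; rewrite (Ldist_xx Y) addr0 lerDr; exact: normr_ge0.
Qed.

Lemma zcont_cst (B : set ((R * L2 mu) * (R * L2 mu))) (c : R) : zcont zdist B (fun=> c).
Proof. by move=> w _ e e0; exists 1 => // y _ _; rewrite subrr normr0. Qed.

Lemma penalized_zcont (r1 r2 : R) :
  continuous_on (@tdist R d) (tspace T) phi1 -> continuous_on (@tdist R d) (tspace T) phi2 ->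
  zcont zdist (box t1 X0 r1 `*` box T X0 r2) penalized.
Proof.
move=> c1 c2.
have cphi1 := zcont_fst (B2 := box T X0 r2) (@phi_zcont _ _ mu T t1 X0 r1 phi1 t1T c1).
have cphi2 := zcont_snd (B1 := box t1 X0 r1) (@phi_zcont _ _ mu T T X0 r2 phi2 (lexx T) c2).
have ct : zcont zdist (box t1 X0 r1 `*` box T X0 r2) (fun z => z.1.1).
  by apply: (@zcont_fst _ _ (fun z => z.1)); exact: zcont_time.
have cs : zcont zdist (box t1 X0 r1 `*` box T X0 r2) (fun z => z.2.1).
  by apply: (@zcont_snd _ _ (fun z => z.1)); exact: zcont_time.
have cX : zcont zdist (box t1 X0 r1 `*` box T X0 r2) (fun z => Ldist z.1.2 X0).
  by apply: (@zcont_fst _ _ (fun z => Ldist z.2 X0)); exact: zcont_dist.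
have cY : zcont zdist (box t1 X0 r1 `*` box T X0 r2) (fun z => Ldist z.2.2 Yh).
  by apply: (@zcont_snd _ _ (fun z => Ldist z.2 Yh)); exact: zcont_dist.
have cXY : zcont zdist (box t1 X0 r1 `*` box T X0 r2) (fun z => Ldist z.1.2 z.2.2).
  apply: (zcont_lip ler01) => y w _ _; rewrite mul1r.
  apply: le_trans (Ldist_lip _ _ _ _) _; apply: lerD; rewrite lerDr; exact: normr_ge0.
have ccone : zcont zdist (box t1 X0 r1 `*` box T X0 r2) (fun z => cone z.1).
  apply: zcontB; first exact: zcontX2.
  by apply: zcontZ; apply: zcontB => //; exact: zcont_cst.
apply: zcontB; last exact: zcontZ.
apply: zcontB; last by apply: zcontZ; apply: zcontX2; exact: zcontB.
apply: zcontB; last by apply: zcontZ; apply: zcontB => //; exact: zcont_cst.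
apply: zcontB; last by apply: zcontZ; apply: zcontX2; exact: zcont_max0.
apply: zcontB; last by apply: zcontZ; exact: zcontX2.
exact: zcontB.
Qed.

Lemma Ldist2_expand (X Xb Y : L2 mu) : Ldist X Y ^+ 2 =
  Ldist Xb Y ^+ 2 +
  2 * ip mu (fun x => (Xb x : 'cV[R]_d) - Y x) (fun x => (X x : 'cV[R]_d) - Xb x) +
  Ldist X Xb ^+ 2.
Proof.
have h1 := sqintB (sqint_L2 Xb) (sqint_L2 Y); have h2 := sqintB (sqint_L2 X) (sqint_L2 Xb).
have := L2norm2D h1 h2.
rewrite (_ : (fun x => _ + _) = (fun x => (X x : 'cV[R]_d) - Y x)) //.
by apply/funext => x; rewrite addrC addrA subrK.
Qed.

(** The function x -> max(x, 0)^2 has derivative 2 max(x, 0), which is Lipschitz with constant 2. *)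
Lemma max0_sqr_le (q q' : R) :
  Num.max q' 0 ^+ 2 <= Num.max q 0 ^+ 2 + 2 * Num.max q 0 * (q' - q) + (q' - q) ^+ 2.
Proof.
have [q0|q0] := leP q 0; have [q1|q1] := leP q' 0.
- by have := sqr_ge0 (q' - q); rewrite expr0n /=; lra.
- have h : 0 <= (- q) * (2 * q' - q) by apply: mulr_ge0; lra.
  by rewrite expr0n /=; lra.
- rewrite expr0n /= (_ : _ + _ = q' ^+ 2) ?sqr_ge0//; ring.
- by rewrite le_eqVlt; apply/orP; left; apply/eqP; ring.
Qed.

(** Of the slope 3 eta, 2 eta comes from the Ekeland term, whose two parts are each at most N. The
    rest pays for the quadratic remainders, bounded by a constant times N^2 with that constant times
    N at most eta. *)
Lemma sub_tangent_scalar (p p' c g tau tb sb n i1 i0 N D2 Dx2 Q Q' : R) :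
  Dx2 = D2 + 2 * i1 + n ^+ 2 -> Q' = Q + 2 * i0 + n ^+ 2 - m * tau ->
  `|i0| <= R0 * n -> 0 <= n -> n <= 1 -> n <= N -> `|tau| <= N ->
  (alpha + beta + 2 * A * Num.max Q 0 + A * (2 * R0 + 1 + m) ^+ 2) * N <= eta ->
  p' - c - alpha * Dx2 - A * Num.max Q' 0 ^+ 2 - lam * (t1 - (tb + tau))
    - beta * (tb + tau - sb) ^+ 2 - g <=
  p - c - alpha * D2 - A * Num.max Q 0 ^+ 2 - lam * (t1 - tb)
    - beta * (tb - sb) ^+ 2 - g + eta * (`|tau| + n) ->
  p' <= p + (2 * beta * (tb - sb) - 2 * A * Num.max Q 0 * m - lam) * tau
    + (2 * alpha * i1 + 4 * A * Num.max Q 0 * i0) + 3 * eta * N.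
Proof.
move=> -> EQ i0n n0 n1 nN tN small.
have Mx := max0_sqr_le Q Q'.
have P0 : 0 <= Num.max Q 0 by rewrite le_max lexx orbT.
move: Mx P0 small; move: (Num.max Q' 0 ^+ 2) (Num.max Q 0) => X2 P Mx P0 small.
have dq : Q' - Q = 2 * i0 + n ^+ 2 - m * tau by rewrite EQ; ring.
have N0 : 0 <= N by exact: le_trans nN.
have nn : n ^+ 2 <= N ^+ 2 by rewrite ler_pXn2r ?nnegrE.
have tt : tau ^+ 2 <= N ^+ 2 by rewrite -[tau ^+ 2]real_normK ?num_real// ler_pXn2r ?nnegrE.
have dqN : (Q' - Q) ^+ 2 <= (2 * R0 + 1 + m) ^+ 2 * N ^+ 2.
  have Cp : 0 <= (2 * R0 + 1 + m) * N by apply: mulr_ge0 => //; rewrite !addr_ge0// mulr_ge0// ltW.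
  rewrite -exprMn -[(Q' - Q) ^+ 2]real_normK ?num_real// ler_pXn2r ?nnegrE//.
  rewrite dq ler_norml; move: i0n tN; rewrite !ler_norml => /andP[a1 a2] /andP[b1 b2].
  have c1 := ler_wpM2l (ltW R0_gt0) nN; have c2 := ler_wpM2l m_ge0 b1; have c3 := ler_wpM2l m_ge0 b2.
  have c4 : n ^+ 2 <= n by rewrite expr2 ler_piMl.
  have c5 := sqr_ge0 n.
  by apply/andP; split; lra.
have S1 := ler_wpM2l alpha_ge0 nn; have S2 := ler_wpM2l beta_ge0 tt.
have S3 := ler_wpM2l (mulr_ge0 (mulr_ge0 (ler0n R 2) A_ge0) P0) nn.
have S4 := ler_wpM2l A_ge0 dqN.
have S5 := ler_wpM2l N0 small.
have S6 := ler_wpM2l A_ge0 Mx.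
have S7 := ler_wpM2l (ltW eta_gt0) tN; have S8 := ler_wpM2l (ltW eta_gt0) nN.
move: S3 S4 S6; rewrite dq; move: S1 S2 S5 S7 S8; clear.
move=> S1 S2 S5 S7 S8 S3 S4 S6 H.
have S9 : N * eta = eta * N by rewrite mulrC.
by lra.
Qed.

Lemma cone_shift (q qb i n c t tb s : R) : q = qb + 2 * i + n ->
  q - c * (t - s) = qb - c * (tb - s) + 2 * i + n - c * (t - tb).
Proof. by move=> ->; ring. Qed.

Lemma cancel_penalties (a p p' q q' r l b b' y y' x : R) :
  a - p' - q' - r - l - b' - y' <= a - p - q - r - l - b - y + x ->
  a - p' - q' - b' - y' <= a - p - q - b - y + x.
Proof. by lra. Qed.

Lemma tangent_radius (c e : R) : 0 <= c -> 0 < e ->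
  exists2 r, 0 < r & r <= 1 /\ c * (2 * r) <= e.
Proof.
move=> c0 e0; have c1 : 0 < 2 * c + 1 by rewrite ltr_wpDl ?mulr_ge0.
exists (Num.min 1 (e / (2 * c + 1))); first by rewrite lt_min ltr01 divr_gt0.
split; first by rewrite ge_min lexx.
apply: (@le_trans _ _ (c * (2 * (e / (2 * c + 1))))).
  by rewrite ler_wpM2l// ler_pM2l// ge_min lexx orbT.
by rewrite !mulrA ler_pdivrMr//; lra.
Qed.

Section AtMaximum.
Variables (tb sb : R) (Xb Yb : L2 mu).
(** The second box is larger so that the second point is interior as soon as the first is within R0
    of X0 and the two are less than R0 apart. *)
Let S := box t1 X0 R0 `*` box T X0 (2 * R0).
Hypothesis Sb : S ((tb, Xb), (sb, Yb)).
Hypothesis max_b : forall z, S z ->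
  penalized z <= penalized ((tb, Xb), (sb, Yb)) + eta * zdist ((tb, Xb), (sb, Yb)) z.

Lemma sub_tangent : tb < t1 -> Ldist Xb X0 < R0 ->
  upper_tangent T phi1 tb Xb
    (2 * beta * (tb - sb) - 2 * A * Num.max (cone (tb, Xb)) 0 * m - lam)
    (fun x => (2 * alpha) *: ((Xb x : 'cV[R]_d) - Yb x) +
       (4 * A * Num.max (cone (tb, Xb)) 0) *: ((Xb x : 'cV[R]_d) - X0 x))
    (3 * eta).
Proof.
move=> tbt1 XbR; set P := Num.max _ 0.
have P0 : 0 <= P by rewrite le_max lexx orbT.
pose c := alpha + beta + 2 * A * P + A * (2 * R0 + 1 + m) ^+ 2.
have c0 : 0 <= c.
  apply: addr_ge0; last exact: mulr_ge0 A_ge0 (sqr_ge0 _).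
  apply: addr_ge0; first exact: addr_ge0.
  exact: mulr_ge0 (mulr_ge0 (ler0n R 2) A_ge0) P0.
have [r r0 [r1 rc]] := tangent_radius c0 eta_gt0.
exists (Num.min r (Num.min (t1 - tb) (R0 - Ldist Xb X0))).
  by rewrite !lt_min r0 !subr_gt0 tbt1.
move=> t X tT; rewrite !lt_min => /and3P[tr tt1 _] /and3P[Xr _ XR].
have hV := sqintB (sqint_L2 X) (sqint_L2 Xb).
have hXY := sqintB (sqint_L2 Xb) (sqint_L2 Yb).
have hX0 := sqintB (sqint_L2 Xb) (sqint_L2 X0).
have [n1 n2] := tnorm_ge mu (t - tb) (fun x => (X x : 'cV[R]_d) - Xb x).
have n3 := tnorm_le_add mu (t - tb) (fun x => (X x : 'cV[R]_d) - Xb x).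
rewrite (ip_linl (2 * alpha) hXY (sqintZ _ hX0) hV) (ipZl _ hX0 hV).
have cs := cauchy_schwarz hX0 hV.
have Dx := Ldist2_expand X Xb Yb; have Qx := Ldist2_expand X Xb X0.
have Sz : S ((t, X), (sb, Yb)).
  split; last by case: Sb.
  split=> /=.
    case/andP: tT => -> _ /=; move: tt1; rewrite ltr_norml => /andP[_].
    by rewrite ltrD2r => /ltW.
  by apply: le_trans (Ldist_tri Xb _ _) _; rewrite -lerBrDr; exact: ltW.
have := max_b Sz; rewrite /penalized /doubled /zdist /sdist /=.
rewrite subrr normr0 (Ldist_xx Yb) !addr0 distrC (Ldist_sym Xb X).
rewrite -/P => ineq.
have ttb : t = tb + (t - tb) by rewrite addrC subrK.
apply: (@sub_tangent_scalar (phi1 (tb, law Xb)) (phi1 (t, law X)) (phi2 (sb, law Yb))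
  (2 * eta * Ldist Yb Yh) (t - tb) tb sb (Ldist X Xb) _ _ _ (Ldist Xb Yb ^+ 2)
  (Ldist X Yb ^+ 2) (cone (tb, Xb)) (cone (t, X)) Dx).
- exact: cone_shift Qx.
- apply: le_trans cs _; rewrite ler_wpM2r ?L2norm_ge0//; exact: ltW.
- exact: Ldist_ge0.
- by apply: ltW; apply: lt_le_trans r1.
- exact: n2.
- exact: n1.
- apply: le_trans rc; apply: ler_wpM2l => //; apply: le_trans n3 _.
  by rewrite mulrDl mul1r; apply: lerD; exact: ltW.
- by rewrite -ttb.
Qed.

(** As for the subsolution, with 2 eta more for the anchor term, which is Lipschitz with constant 2
    eta but need not be differentiable. *)
Lemma super_tangent_scalar (p p' c tau n i N D2 Dx2 y y' s : R) :
  Dx2 = D2 - 2 * i + n ^+ 2 -> `|y - y'| <= n -> 0 <= n -> n <= N -> `|tau| <= N ->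
  (alpha + beta) * N <= eta ->
  c - p' - alpha * Dx2 - beta * (s - tau) ^+ 2 - 2 * eta * y' <=
  c - p - alpha * D2 - beta * s ^+ 2 - 2 * eta * y + eta * (`|tau| + n) ->
  - p' <= - p + - (2 * beta * s) * tau + -1 * (2 * alpha * i) + 5 * eta * N.
Proof.
move=> -> yn n0 nN tN small.
have N0 : 0 <= N by exact: le_trans nN.
have nn : n ^+ 2 <= N ^+ 2 by rewrite ler_pXn2r ?nnegrE.
have tt : tau ^+ 2 <= N ^+ 2 by rewrite -[tau ^+ 2]real_normK ?num_real// ler_pXn2r ?nnegrE.
have S1 := ler_wpM2l alpha_ge0 nn; have S2 := ler_wpM2l beta_ge0 tt.
have S5 := ler_wpM2l N0 small.
have S7 := ler_wpM2l (ltW eta_gt0) tN; have S8 := ler_wpM2l (ltW eta_gt0) nN.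
move: yn; rewrite ler_norml => /andP[y1 y2].
have S9 := ler_wpM2l (ltW eta_gt0) y1.
by lra.
Qed.

Lemma super_tangent : Ldist Yb X0 < 2 * R0 ->
  upper_tangent T (fun z => - phi2 z) sb Yb (- (2 * beta * (tb - sb)))
    (fun x => (-1) *: ((2 * alpha) *: ((Xb x : 'cV[R]_d) - Yb x))) (5 * eta).
Proof.
move=> YbR.
have [r r0 [_ rc]] := tangent_radius (addr_ge0 alpha_ge0 beta_ge0) eta_gt0.
exists (Num.min r (2 * R0 - Ldist Yb X0)); first by rewrite !lt_min r0 !subr_gt0.
move=> s Y sT; rewrite !lt_min => /andP[sr _] /andP[Yr YR].
have hV := sqintB (sqint_L2 Y) (sqint_L2 Yb).
have hXY := sqintB (sqint_L2 Xb) (sqint_L2 Yb).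
have [n1 n2] := tnorm_ge mu (s - sb) (fun x => (Y x : 'cV[R]_d) - Yb x).
have n3 := tnorm_le_add mu (s - sb) (fun x => (Y x : 'cV[R]_d) - Yb x).
rewrite (ipZl (-1) (sqintZ _ hXY) hV) (ipZl _ hXY hV).
have Dx := Ldist2_expand Y Yb Xb.
have ipN : ip mu (fun x => (Yb x : 'cV[R]_d) - Xb x) (fun x => (Y x : 'cV[R]_d) - Yb x) =
    - ip mu (fun x => (Xb x : 'cV[R]_d) - Yb x) (fun x => (Y x : 'cV[R]_d) - Yb x).
  rewrite -mulN1r -(ipZl (-1) hXY hV); congr (ip mu _ _); apply/funext => x.
  by rewrite scaleN1r opprB.
have Sz : S ((tb, Xb), (s, Y)).
  split; first by case: Sb.
  split; first exact: sT.
  by apply: le_trans (Ldist_tri Yb _ _) _; rewrite -lerBrDr; exact: ltW.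
have := max_b Sz; rewrite /penalized /doubled /zdist /sdist /=.
rewrite subrr normr0 (Ldist_xx Xb) !add0r => ineq.
apply: (@super_tangent_scalar (phi2 (sb, law Yb)) (phi2 (s, law Y)) (phi1 (tb, law Xb))
  (s - sb) (Ldist Y Yb) _ _ (Ldist Xb Yb ^+ 2) (Ldist Xb Y ^+ 2) (Ldist Yb Yh) (Ldist Y Yh) (tb - sb)).
- by rewrite (Ldist_sym Xb Y) (Ldist_sym Xb Yb) Dx ipN mulrN.
- by apply: le_trans (Ldist_lip _ _ _ _) _; rewrite (Ldist_xx Yh) addr0 Ldist_sym.
- exact: Ldist_ge0.
- exact: n2.
- exact: n1.
- apply: le_trans rc; apply: ler_wpM2l; first exact: addr_ge0.
  apply: le_trans n3 _.
  by rewrite mulrDl mul1r; apply: lerD; exact: ltW.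
- rewrite distrC (Ldist_sym Yb Y) in ineq.
  have -> : tb - sb - (s - sb) = tb - s by ring.
  exact: cancel_penalties ineq.
Qed.

End AtMaximum.
End PenalizedTangents.

(** * Combining the two viscosity inequalities at an almost maximum point *)

Section MaximumInequality.
Context {R : realType} {d : nat} {U : metricType R}.
Variables (T : R) (f : R -> 'cV[R]_d -> P2 R d -> U -> 'cV[R]_d).
Variables (L : R -> P2 R d -> U -> R).

Lemma maximum_scalar (a l A P c0 R0 al b1 b2 g1 l1 l2 D om N K e1 e2 : R) :
  0 <= A -> 0 <= P -> 0 <= al ->
  - e1 <= a - 2 * A * P * (4 * c0 * R0 ^+ 2) - l + (2 * al * b1 + 4 * A * P * g1) + l1 ->
  a + 2 * al * b2 + l2 <= e2 ->
  b1 - b2 <= D * (2 * om * (1 + 2 * N) + 4 * K * D) ->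
  g1 <= R0 * (c0 * (2 * R0)) ->
  l <= e1 + e2 + 2 * al * (D * (2 * om * (1 + 2 * N) + 4 * K * D)) + (l1 - l2).
Proof.
move=> A0 P0 al0 H1 H2 Hb Hg.
have S1 := ler_wpM2l (mulr_ge0 (ler0n R 2) al0) Hb.
have S2 := ler_wpM2l (mulr_ge0 (mulr_ge0 (ler0n R 4) A0) P0) Hg.
by lra.
Qed.

(** Subtracting the two inequalities cancels [a]. The drift part of the cone penalty is at most 4 A
    P * R0 * 2 c0 R0, exactly its time part 2 A P * 4 c0 R0^2, so no term in A survives. *)
Lemma maximum_inequality (mu : P2 R d) (K : R) (omega : R -> R)
    (X0 Xb Yb : L2 mu) (tb sb a lam A P c0 R0 alpha e1 e2 : R) u :
  0 <= K ->
  (forall s x y m n u, 0 <= s <= T ->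
    enorm (f s x m u - f s y n u) <= K * (enorm (x - y) + W2 m n)) ->
  (forall r, 0 <= r -> 0 <= omega r) ->
  (forall s r x m u, 0 <= s <= T -> 0 <= r <= T ->
    enorm (f s x m u - f r x m u) <= omega `|s - r| * (1 + enorm x + varsigma m)) ->
  0 <= tb <= T -> 0 <= sb <= T -> 0 <= A -> 0 <= P -> 0 <= alpha -> 0 <= c0 ->
  L2norm mu (fun x => f tb (Xb x) (law Xb) u) <= c0 * (1 + L2norm mu Xb) ->
  1 + L2norm mu Xb <= 2 * R0 -> Ldist Xb X0 <= R0 ->
  - e1 <= a - 2 * A * P * (4 * c0 * R0 ^+ 2) - lam +
    ip mu (fun x => (2 * alpha) *: ((Xb x : 'cV[R]_d) - Yb x) +
       (4 * A * P) *: ((Xb x : 'cV[R]_d) - X0 x)) (fun x => f tb (Xb x) (law Xb) u)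
    + L tb (law Xb) u ->
  a + ip mu (fun x => (2 * alpha) *: ((Xb x : 'cV[R]_d) - Yb x))
    (fun x => f sb (Yb x) (law Yb) u) + L sb (law Yb) u <= e2 ->
  lam <= e1 + e2 + 2 * alpha * (Ldist Xb Yb * (2 * omega `|tb - sb| * (1 + 2 * L2norm mu Xb)
     + 4 * K * Ldist Xb Yb)) + (L tb (law Xb) u - L sb (law Yb) u).
Proof.
move=> K0 fK o0 fo tT sT A0 P0 al0 c00 fb X2 XR H1 H2.
have hf1 := sqint_law (sqint_drift K0 fK (law Xb) u (law Xb) tT).
have hf2 := sqint_law (sqint_drift K0 fK (law Yb) u (law Yb) sT).
have hXY := sqintB (sqint_L2 Xb) (sqint_L2 Yb).
have hX0 := sqintB (sqint_L2 Xb) (sqint_L2 X0).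
rewrite (ip_linl (2 * alpha) hXY (sqintZ _ hX0) hf1) (ipZl _ hX0 hf1) in H1.
rewrite (ipZl _ hXY hf2) in H2.
apply: (maximum_scalar A0 P0 al0 H1 H2).
  rewrite (ipC mu _ (fun x => f tb _ _ _)) (ipC mu _ (fun x => f sb _ _ _)) -(ipBl hf1 hf2 hXY) ipC.
  apply: le_trans (ler_norm _) _; apply: le_trans (cauchy_schwarz hXY (sqintB hf1 hf2)) _.
  apply: ler_wpM2l; first exact: L2norm_ge0.
  exact: (drift_diff K0 fK o0 fo Xb Yb u tT sT).
apply: le_trans (ler_norm _) _; apply: le_trans (cauchy_schwarz hX0 hf1) _.
apply: ler_pM => //; [exact: L2norm_ge0|exact: L2norm_ge0|].
by apply: le_trans fb _; exact: ler_wpM2l.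
Qed.

End MaximumInequality.

(** * Real inequalities for one comparison step *)

Section StepScalars.
Context {R : realType}.

(** With coefficient (M + 1) / x^2, any D >= x would cost at least M + 1. This is the origin of [A],
    [alpha] and [beta]. *)
Lemma small_from_penalty (M x D : R) : 0 <= M -> 0 < x -> 0 <= D ->
  (M + 1) / x ^+ 2 * D ^+ 2 <= M -> D < x.
Proof.
move=> M0 x0 D0 H; rewrite ltNge; apply/negP => xD.
have x2 : 0 < x ^+ 2 by rewrite exprn_gt0.
have xD2 : x ^+ 2 <= D ^+ 2 by rewrite ler_pXn2r ?nnegrE// ltW.
have c0 : 0 <= (M + 1) / x ^+ 2 by rewrite divr_ge0 ?addr_ge0// ltW.
have := le_trans (ler_wpM2l c0 xD2) H; rewrite divfK ?lt0r_neq0//; lra.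
Qed.

Lemma penalties_le (M v q a b c e y : R) : 0 <= a -> 0 <= b -> 0 <= c -> 0 <= e -> 0 <= y ->
  0 <= v -> q <= M -> v <= q - a - b - c - e - y -> [/\ a <= M, b <= M, e <= M & v <= q].
Proof. by move=> *; split; lra. Qed.

Lemma sub3_le (q a b c : R) : 0 <= a -> 0 <= b -> 0 <= c -> q - a - b - c <= q.
Proof. by lra. Qed.

Lemma sub2_le (q a b : R) : 0 <= a -> 0 <= b -> q - b - a <= q.
Proof. by lra. Qed.

Lemma half_left (s l : R) : l <= s / 2 -> s / 2 <= s - l.
Proof. by lra. Qed.

Lemma quarter_left (s a b e q : R) : s / 2 <= a -> a <= b -> b - e < q -> e <= s / 4 -> s / 4 <= q.
Proof. by lra. Qed.

(** The competitor moves Y onto X: [phi2] changes by less than e, and the anchor and Ekeland terms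
    by at most 3 D <= e. Thus alpha D^2, not merely D, is small. *)
Lemma doubling_le (p p2 p2' al D r l b eta y y' e d1 d2 d3 : R) : 0 <= eta -> eta <= 1 -> 0 <= D ->
  D <= e / 3 -> `|y' - y| <= D -> `|p2' - p2| < e -> d1 = 0 -> d2 = 0 -> d3 = 0 ->
  p - p2' - al * d1 ^+ 2 - r - l - b - 2 * eta * y' <=
  p - p2 - al * D ^+ 2 - r - l - b - 2 * eta * y + eta * (d2 + (d3 + D)) ->
  al * D ^+ 2 <= 2 * e.
Proof.
move=> eta0 eta1 D0 De; rewrite ler_norml ltr_norml => /andP[_ yy] /andP[_ pp] -> -> ->.
have h1 : eta * (y' - y) <= eta * D by exact: ler_wpM2l.
have h2 : eta * D <= D by exact: ler_piMl.
by rewrite expr0n /=; lra.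
Qed.

(** Moving the second point to the time of the first makes it a competitor for the supremum S, at
    the price eta^2. As the anchor maximizes up to another eta^2, 2 eta y is at most 2 eta^2. *)
Lemma anchor_le (S F' Fb Fh p2 p2' bt eta y dd : R) : 0 < eta -> 0 <= bt -> 0 <= dd ->
  `|p2' - p2| < eta ^+ 2 -> F' = Fb + (p2 - p2') -> F' <= S -> S - eta ^+ 2 < Fh ->
  Fh + eta * dd <= Fb - bt - 2 * eta * y -> y <= eta.
Proof.
move=> eta0 b0 dd0; rewrite ltr_norml => /andP[_ pp] FE FS Sh H.
have h := mulr_ge0 (ltW eta0) dd0.
by rewrite -(ler_pM2l eta0) -expr2; lra.
Qed.

(** The condition 8 c0 (t1 - s) <= 1 lets the cone widen rho^2 by at most R0^2 / 2; the other half
    is the tolerance of the penalty. *)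
Lemma cone_radius (rho R0 m c0 t s t1 : R) : 0 <= rho -> 0 < R0 -> 0 < c0 ->
  m = 4 * c0 * R0 ^+ 2 -> 8 * c0 * (t1 - s) <= 1 -> t <= t1 ->
  rho ^+ 2 - m * (t - s) < R0 ^+ 2 / 2 -> rho < R0.
Proof.
move=> rho0 R00 c00 -> tc tt1 H.
rewrite -(ltr_pXn2r (n := 2)) ?nnegrE ?(ltW R00)//.
have R2 : 0 < R0 ^+ 2 by rewrite exprn_gt0.
have h1 := ler_wpM2l (ltW R2) tc.
have h2 : c0 * R0 ^+ 2 * (t - s) <= c0 * R0 ^+ 2 * (t1 - s).
  by rewrite ler_wpM2l ?lerD2r// mulr_ge0 ?ltW.
by lra.
Qed.

Lemma cone_left (rho m t s : R) : 0 < m -> rho ^+ 2 - m * (t - s) < m * (s / 2) -> s / 2 < t.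
Proof.
move=> m0 H; rewrite -(ltr_pM2l m0).
by have := sqr_ge0 rho; move: H; lra.
Qed.

Lemma time_margin (t s t1 r : R) : `|t - s| < r -> t <= t1 - r -> s < t1.
Proof. by rewrite ltr_norml => /andP[h _] h2; lra. Qed.

Lemma time_positive (t s c : R) : `|t - s| < c -> c < t -> 0 < s.
Proof. by rewrite ltr_norml => /andP[_ h] h2; lra. Qed.

Lemma near_terminal (t t1 r : R) : t <= t1 -> t1 - r < t -> `|t - t1| < r.
Proof. by move=> h1 h2; rewrite ltr_norml; apply/andP; split; lra. Qed.

Lemma three_thirds (t s t1 D c : R) : `|t - t1| < c / 3 -> `|t - s| < c / 3 -> D < c / 3 ->
  `|s - t1| + D < c.
Proof.
move=> h1 h2 h3; have : `|s - t1| <= `|t - s| + `|t - t1|.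
  by rewrite (distrC t s); exact: ler_distD.
by lra.
Qed.

(** From X to Y to the anchor at the first time, then the change of time at the anchor, then back to
    Y at the second time. *)
Lemma cost_chain (l1 l2 l3 l4 l5 KL w1 w2 w3 D y eta : R) : 0 <= KL ->
  `|l1 - l2| <= KL * w1 -> `|l2 - l3| <= KL * w2 -> `|l3 - l4| < eta -> `|l4 - l5| <= KL * w3 ->
  w1 <= D -> w2 <= y -> w3 <= y -> y <= eta -> l1 - l5 <= KL * D + 2 * KL * eta + eta.
Proof.
move=> K0; rewrite !ler_norml ltr_norml => /andP[_ h1] /andP[_ h2] /andP[_ h3] /andP[_ h4] h5 h6 h7 h8.
have e1 := ler_wpM2l K0 h5.
have e2 := ler_wpM2l K0 (le_trans h6 h8); have e3 := ler_wpM2l K0 (le_trans h7 h8).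
by lra.
Qed.

Lemma time_swap (p p2 p2' q r l : R) :
  p - p2' - q - r - l = p - p2 - q - r - l + (p2 - p2').
Proof. by ring. Qed.

Lemma modulus_budget (al D om N R0 xo c : R) : 0 <= al -> 0 <= D -> 0 <= om -> 0 <= N ->
  D <= R0 -> N <= 2 * R0 -> om <= xo ->
  (forall y, 0 <= y -> y <= xo -> al * R0 * (1 + 2 * (2 * R0)) * y <= c) ->
  al * D * (om * (1 + 2 * N)) <= c.
Proof.
move=> al0 D0 om0 N0 DR NR ox H; apply: le_trans (H om om0 ox).
rewrite [om * _]mulrC [al * D * _]mulrA ler_wpM2r//; apply: ler_pM.
- exact: mulr_ge0.
- by apply: addr_ge0 => //; exact: mulr_ge0.
- exact: ler_wpM2l.
- by rewrite lerD2l ler_wpM2l.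
Qed.

(** The slope errors use lam / 4, the Lipschitz term 8 K alpha D^2 <= 16 K e another lam / 4, the
    cost and the time modulus lam / 8 each: in total less than lam. *)
Lemma final_absurd (lam eta C1 C2 K KL al D om N e dL : R) : 0 < lam -> 0 <= K -> 0 <= e ->
  lam <= C1 * (3 * eta) + (C2 * (5 * eta) + eta) +
    2 * al * (D * (2 * om * (1 + 2 * N) + 4 * K * D)) + dL ->
  dL <= KL * D + 2 * KL * eta + eta ->
  eta * (3 * C1 + 5 * C2 + 2 * KL + 2) <= lam / 4 ->
  al * D ^+ 2 <= 2 * e -> 64 * (K + 1) * e <= lam -> KL * D <= lam / 8 ->
  al * D * (om * (1 + 2 * N)) <= lam / 32 -> False.
Proof.
move=> l0 K0 e0 H1 H2 H3 H4 H5 H6 H7.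
have := ler_wpM2l K0 H4; lra.
Qed.

Lemma margin_absurd (sg p1 p1' p2 p2' : R) : `|p1 - p1'| < sg / 8 -> `|p2 - p2'| < sg / 8 ->
  p1' <= p2' -> sg / 4 <= p1 - p2 -> False.
Proof. by rewrite !ltr_norml => /andP[_ h1] /andP[h2 _] h3 h4; lra. Qed.

Lemma divide_budget (a b : R) : 0 < a -> 0 <= b -> exists2 x, 0 < x & forall y, 0 <= y -> y <= x -> b * y <= a.
Proof.
move=> a0 b0; have b1 : 0 < b + 1 by rewrite ltr_wpDl.
exists (a / (b + 1)); first by rewrite divr_gt0.
move=> y y0; rewrite ler_pdivlMr// => ya; apply: le_trans ya.
by rewrite mulrC ler_wpM2l// lerDl.
Qed.

End StepScalars.

Lemma W2_Ldist_sym (R : realType) (d : nat) (mu : P2 R d) (X Y : L2 mu) :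
  W2 (law X) (law Y) <= Ldist Y X.
Proof. by rewrite Ldist_sym; exact: W2_law. Qed.

(** * One step of the comparison backward in time *)

Section ComparisonStep.
Context {R : realType} {d : nat} {U : metricType R}.
Variables (T : R) (f : R -> 'cV[R]_d -> P2 R d -> U -> 'cV[R]_d).
Variables (L : R -> P2 R d -> U -> R).

(* The data of L are compared at the fixed law of Yh, an almost maximizer chosen
   before the time penalty beta: L is not uniformly continuous in time on
   bounded sets, which need not be relatively compact. *)
Lemma comparison_step (mu : P2 R d) (phi1 phi2 : R * P2 R d -> R) (c0 t0 t1 : R) (X0 : L2 mu) :
  0 < T -> @C1 R U -> C2 T f -> C3 T f -> C4 T L ->
  continuous_on (@tdist R d) (tspace T) phi1 -> continuous_on (@tdist R d) (tspace T) phi2 ->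
  UC (@tdist R d) (tspace T) phi1 -> UC (@tdist R d) (tspace T) phi2 ->
  strict_subsolution T f L phi1 -> strict_supersolution T f L phi2 ->
  0 < c0 ->
  (forall s (X : L2 mu) u, 0 <= s <= T ->
    L2norm mu (fun x => f s (X x) (law X) u) <= c0 * (1 + L2norm mu X)) ->
  t1 <= T -> (forall X : L2 mu, phi1 (t1, law X) <= phi2 (t1, law X)) ->
  0 < t0 -> t0 <= t1 -> 8 * c0 * (t1 - t0) <= 1 ->
  phi1 (t0, law X0) <= phi2 (t0, law X0).
Proof.
move=> T0 hC1 [omega [oc o0 o00 fo]] hC3 hC4 pc1 pc2 uc1 uc2 sub1 sup2 c00 fb t1T le1 t00 t01 tc.
have [K K0 fK] := hC3; have [_ [KL KL0 LK]] := hC4.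
rewrite leNgt; apply/negP; rewrite -subr_gt0; set sg := _ - _ => sg0.
(* Then |X - X0| <= R0 implies 1 + |X| <= 2 R0, the form in which the growth bound on f meets the
   speed of the cone. *)
pose R0 := 1 + L2norm mu X0.
have R00 : 0 < R0 by rewrite ltr_pwDl// L2norm_ge0.
have R2 : 0 <= 2 * R0 by rewrite mulr_ge0// ltW.
pose m := 4 * c0 * R0 ^+ 2.
have m0 : 0 < m by rewrite !mulr_gt0// exprn_gt0.
have [c1 c10 H1] := lifted_subsolution hC3 pc1 X0 (2 * R0) sub1.
have [c2 c20 H2] := lifted_supersolution hC3 pc2 X0 (2 * R0) sup2.
have [M1 M1P] := sub1.1.2 _ (@box_tspace _ _ _ T T X0 (2 * R0) (lexx _)) (tdist_box_bounded T X0 (2 * R0)).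
have [M2 M2P] := sup2.1.2 _ (@box_tspace _ _ _ T T X0 (2 * R0) (lexx _)) (tdist_box_bounded T X0 (2 * R0)).
pose M := `|M1 - M2|.
have M0 : 0 <= M by exact: normr_ge0.
pose S := box t1 X0 R0 `*` box T X0 (2 * R0).
have boxT z : box t1 X0 R0 z -> box T X0 (2 * R0) z.
  move=> [/andP[z0 z1] zr]; split; first by rewrite z0 (le_trans z1).
  by apply: le_trans zr _; rewrite mulr_natl mulr2n lerDl ltW.
have phiM z : S z -> phi1 (z.1.1, law z.1.2) - phi2 (z.2.1, law z.2.2) <= M.
  move=> [z1 z2]; apply: le_trans (ler_norm _); apply: lerB.
    by apply: M1P; exists z.1; [exact: boxT|exact: erefl].
  by apply: M2P; exists z.2; [exact: z2|exact: erefl].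
(* The penalty [lam * (t1 - t0)] takes at most half of the gap [sg]. *)
pose lam := sg / (2 * T).
have lam0 : 0 < lam by rewrite divr_gt0// mulr_gt0.
(* The first bound keeps the maximum point after time t0 / 2, the second keeps it strictly within R0
   of X0. *)
pose xA := Num.min (m * (t0 / 2)) (R0 ^+ 2 / 2).
have xA0 : 0 < xA by rewrite lt_min !(mulr_gt0, divr_gt0)// exprn_gt0.
pose A := (M + 1) / xA ^+ 2.
have A0 : 0 <= A by rewrite divr_ge0 ?addr_ge0// exprn_ge0// ltW.
have cc0 : 0 <= 3 * c1 + 5 * c2 + 2 * KL + 2 by rewrite !addr_ge0 ?mulr_ge0.
have lam4 : 0 < lam / 4 by rewrite divr_gt0.
have [xe xe0 xeP] := divide_budget lam4 cc0.
pose eta := Num.min 1 (Num.min (sg / 4) xe).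
have eta0 : 0 < eta by rewrite !lt_min ltr01 divr_gt0.
have eta1 : eta <= 1 by rewrite ge_min lexx.
have etas : eta <= sg / 4 by rewrite !ge_min lexx orbT.
have etac : eta * (3 * c1 + 5 * c2 + 2 * KL + 2) <= lam / 4.
  by rewrite mulrC; apply: xeP; [exact: ltW|rewrite !ge_min lexx !orbT].
have [e e0 eP] := divide_budget lam0 (mulr_ge0 (ler0n R 64) (addr_ge0 K0 ler01)).
have eK : 64 * (K + 1) * e <= lam by apply: eP; [exact: ltW|exact: lexx].
have [de de0 deP] := UC_box X0 (2 * R0) uc2 e0.
have sg8 : 0 < sg / 8 by rewrite divr_gt0.
have [d1 d10 d1P] := UC_box X0 (2 * R0) uc1 sg8.
have [d2 d20 d2P] := UC_box X0 (2 * R0) uc2 sg8.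
have lam8 : 0 < lam / 8 by rewrite divr_gt0.
have [xl xl0 xlP] := divide_budget lam8 KL0.
(* [de] and [e / 3] serve [doubling_le], [xl] the Lipschitz error of L, [d2 / 3] the exclusion of
   the terminal time, [R0] the interior position of the second point. *)
pose D0 := Num.min de (Num.min (e / 3) (Num.min xl (Num.min (d2 / 3) R0))).
have D00 : 0 < D0 by rewrite !lt_min de0 xl0 R00 !divr_gt0.
pose alpha := (M + 1) / D0 ^+ 2.
have al0 : 0 <= alpha by rewrite divr_ge0 ?addr_ge0// exprn_ge0// ltW.
pose F := doubled phi1 phi2 X0 t0 t1 m A lam alpha.
(* On equal times the penalty in [beta] vanishes, so the almost maximizer [zh] can be fixed before
   [beta] and still has the same value under [Psi]. *)
pose SF := [set z | S z /\ z.2.1 = z.1.1].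
have zz : SF ((t0, X0), (t0, X0)).
  split=> //; split; split; rewrite /= ?Ldist_xx ?(ltW t00) ?(ltW R00)//.
  by rewrite (le_trans t01).
have pen0 z : S z -> [/\ 0 <= alpha * Ldist z.1.2 z.2.2 ^+ 2,
    0 <= A * Num.max (cone X0 t0 m z.1) 0 ^+ 2 & 0 <= lam * (t1 - z.1.1)].
  move=> [[/andP[_ z1] _] _]; split; rewrite mulr_ge0 ?sqr_ge0 ?subr_ge0//; exact: ltW.
have FM z : S z -> F z <= M.
  move=> Sz; have [p1 p2 p3] := pen0 z Sz; apply: le_trans (phiM z Sz).
  exact: sub3_le.
have supF : has_sup (F @` SF).
  split; first by exists (F ((t0, X0), (t0, X0))); exists ((t0, X0), (t0, X0)); [exact: zz|exact: erefl].
  by exists M => _ [z [Sz _] <-]; exact: FM.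
have F0 : sg / 2 <= F ((t0, X0), (t0, X0)).
  rewrite /F /doubled /cone /= -/sg !Ldist_xx expr0n /= subrr !mulr0 subrr maxxx expr0n /= !mulr0 !subr0.
  have : lam * (t1 - t0) <= lam * T by rewrite ler_pM2l// lerBlDr (le_trans t1T)// lerDl ltW.
  have -> : lam * T = sg / 2 by rewrite /lam; field; rewrite lt0r_neq0.
  exact: half_left.
have eta2 : 0 < eta ^+ 2 by rewrite exprn_gt0.
have [_ [zh Szh <-] Fzh] := sup_adherent eta2 supF.
have FS : forall z, SF z -> F z <= sup (F @` SF).
  by move=> z Sz; apply: ub_le_sup; [case: supF|exists z; [exact: Sz|exact: erefl]].
have eta2s : eta ^+ 2 <= sg / 4.
  by apply: le_trans etas; rewrite expr2 ler_piMl// ltW.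
have Fh : sg / 4 <= F zh.
  exact: quarter_left F0 (FS _ zz) Fzh eta2s.
pose Yh := zh.2.2.
have [d3 d30 d3P] := UC_box X0 (2 * R0) uc2 eta2.
have [dL dL0 dLP] := running_cost_unif hC1 hC4 (law Yh) eta0.
have lam32 : 0 < lam / 32 by rewrite divr_gt0.
have aR0 : 0 <= alpha * R0 * (1 + 2 * (2 * R0)).
  apply: mulr_ge0; first exact: mulr_ge0 al0 (ltW R00).
  exact: addr_ge0 ler01 (mulr_ge0 (ler0n R 2) R2).
have [xo xo0 xoP] := divide_budget lam32 aR0.
have [dw dw0 dwP] := modulus_small oc o00 xo0.
(* Here [d1] and [d2 / 3] concern the terminal time, [d3] the anchor, [dL] the cost, [dw] the
   modulus of f, and [t0 / 2] keeps the second time positive. Both [dw] (through alpha) and [dL]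
   (through [Yh]) need the earlier choices. *)
pose tau := Num.min d1 (Num.min (d2 / 3) (Num.min d3 (Num.min dL (Num.min dw (t0 / 2))))).
have tau0 : 0 < tau by rewrite !lt_min d10 d30 dL0 dw0 !divr_gt0.
pose beta := (M + 1) / tau ^+ 2.
have be0 : 0 <= beta by rewrite divr_ge0 ?addr_ge0// exprn_ge0// ltW.
pose Psi := penalized phi1 phi2 X0 Yh t0 t1 m A lam alpha beta eta.
have pc : zcont zdist S Psi by apply: penalized_zcont.
have PsiM z : S z -> Psi z <= M.
  move=> Sz; apply: le_trans (FM z Sz).
  have := mulr_ge0 be0 (sqr_ge0 (z.1.1 - z.2.1)).
  have := mulr_ge0 (mulr_ge0 (ler0n R 2) (ltW eta0)) (Ldist_ge0 z.2.2 Yh).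
  exact: sub2_le.
have [[[tb Xb] [sb Yb]] [Sw w1 w2]] := ekeland (@zdist_tri _ _ mu) (@zdist_xx _ _ mu)
  (@zdist_ge0 _ _ mu) (@boxes_complete _ _ mu t1 T X0 R0 (2 * R0)) (zcont_usc pc) PsiM eta0 Szh.1.
have [[/= /andP[tb0 tb1] XbR] [/= /andP[sb0 sbT] YbR]] := Sw.
have zhE : zh.1.1 - zh.2.1 = 0 by rewrite Szh.2 subrr.
have Psih : Psi zh = F zh.
  by rewrite /Psi /penalized -/(F zh) zhE expr0n /= !mulr0 subr0 /Yh Ldist_xx mulr0 subr0.
have Psib : sg / 4 <= Psi ((tb, Xb), (sb, Yb)).
  apply: le_trans w1; rewrite Psih; apply: le_trans Fh _.
  by rewrite lerDl mulr_ge0 ?zdist_ge0// ltW.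
have [q1 q2 q3] := pen0 _ Sw.
have q4 := mulr_ge0 be0 (sqr_ge0 (tb - sb)).
have q5 := mulr_ge0 (mulr_ge0 (ler0n R 2) (ltW eta0)) (Ldist_ge0 Yb Yh).
have sg4 : 0 <= sg / 4 by rewrite divr_ge0// ltW.
have [u1 u2 u3 u4] := penalties_le q1 q2 q3 q4 q5 sg4 (phiM _ Sw) Psib.
have DD : Ldist Xb Yb < D0 := small_from_penalty M0 D00 (Ldist_ge0 Xb Yb) u1.
have PA : Num.max (cone X0 t0 m (tb, Xb)) 0 < xA.
  by apply: small_from_penalty u2 => //; rewrite le_max lexx orbT.
have tst : `|tb - sb| < tau.
  by apply: (small_from_penalty M0 tau0 (normr_ge0 _)); rewrite real_normK ?num_real.
have Dn0 := Ldist_ge0 Xb Yb.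
move: DD; rewrite !lt_min => /and5P[Dde De3 Dxl Dd2 DR0].
move: (tst); rewrite !lt_min => /and5P[s1 s2 s3 sL] /andP[sw st0].
move: (PA); rewrite gt_max => /andP[+ _]; rewrite lt_min /cone /= => /andP[cl cr].
have XbR0 : Ldist Xb X0 < R0 := cone_radius (Ldist_ge0 Xb X0) R00 c00 erefl tc tb1 cr.
have tbl : t0 / 2 < tb := cone_left m0 cl.
have tbb := boxT _ Sw.1; have sbb := Sw.2.
(* Nearer to t1, both values would be within sg / 8 of their values at (t1, law Xb), where [phi1] is
   at most [phi2]; but their difference is still at least sg / 4. *)
have tbr : tb <= t1 - Num.min d1 (d2 / 3).
  rewrite leNgt; apply/negP => h.
  have := near_terminal tb1 h; rewrite lt_min => /andP[n1 n2].
  have t1b : box T X0 (2 * R0) (t1, Xb).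
    by apply: boxT; split=> //=; rewrite lexx andbT (le_trans tb0).
  apply: (margin_absurd (d1P (tb, Xb) (t1, Xb) tbb t1b _) (d2P (sb, Yb) (t1, Xb) sbb t1b _) (le1 Xb) u4).
    by rewrite /sdist /= Ldist_xx addr0.
  by rewrite /sdist /= (Ldist_sym Yb Xb); exact: three_thirds n2 s2 Dd2.
have tbt1 : tb < t1.
  by apply: le_lt_trans tbr _; rewrite ltrBlDr ltrDl lt_min d10 divr_gt0.
have sbt1 : sb < t1 by apply: (time_margin _ tbr); rewrite lt_min s1.
have sbp : 0 < sb := time_positive st0 tbl.
have tbT : 0 < tb < T.
  by rewrite (lt_trans _ tbl) ?divr_gt0//= (lt_le_trans tbt1).
have sbT' : 0 < sb < T by rewrite sbp (lt_le_trans sbt1).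
have tbT'' : 0 <= tb <= T by case/andP: tbT => *; rewrite !ltW.
have sbT'' : 0 <= sb <= T by rewrite sb0.
have YbR0 : Ldist Yb X0 < 2 * R0.
  apply: le_lt_trans (Ldist_tri Xb _ _) _; rewrite mulr_natl mulr2n (Ldist_sym Yb Xb).
  exact: (ltrD DR0 XbR0).
have tg1 := sub_tangent R00 (ltW m0) A0 al0 be0 eta0 Sw w2 tbt1 XbR0.
have tg2 := super_tangent al0 be0 eta0 Sw w2 YbR0.
have hXY := sqintB (sqint_L2 Xb) (sqint_L2 Yb).
have hX0 := sqintB (sqint_L2 Xb) (sqint_L2 X0).
have e3 : 0 < 3 * eta by rewrite mulr_gt0.
have e5 : 0 < 5 * eta by rewrite mulr_gt0.
have [u Hu] := H2 _ _ _ _ _ _ sbT' (ltW YbR0) e5 eta0 (sqintZ _ hXY) tg2.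
have Hs := H1 _ _ _ _ _ u tbT (proj2 tbb) e3 (sqint_lin _ hXY (sqintZ _ hX0)) tg1.
have NX : 1 + L2norm mu Xb <= 2 * R0.
  have := L2norm_le_add (sqint_L2 Xb) (sqint_L2 X0).
  have := ltW XbR0; rewrite /R0 /Ldist.
  by move: (L2norm _ _) (L2norm _ _) (L2norm _ _) => n1 n2 n3 h1 h2; clear -h1 h2; lra.
have P0 : 0 <= Num.max (cone X0 t0 m (tb, Xb)) 0 by rewrite le_max lexx orbT.
have MI := maximum_inequality K0 fK o0 fo tbT'' sbT'' A0 P0 al0 (ltW c00) (fb tb Xb u tbT'') NX (ltW XbR0) Hs Hu.
have tYb : box T X0 (2 * R0) (tb, Yb) by split; [exact: tbT''|exact: (proj2 sbb)].
have ye : Ldist Yb Yh <= eta.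
  apply: (@anchor_le _ (sup (F @` SF)) (F ((tb, Xb), (tb, Yb))) (F ((tb, Xb), (sb, Yb))) (F zh)
    (phi2 (sb, law Yb)) (phi2 (tb, law Yb)) (beta * (tb - sb) ^+ 2) _ _
    (zdist zh ((tb, Xb), (sb, Yb))) eta0 q4 (zdist_ge0 _ _) _ _ _ Fzh).
  - by apply: (d3P (tb, Yb) (sb, Yb) tYb sbb); rewrite /sdist /= Ldist_xx addr0.
  - by rewrite /F /doubled /=; exact: time_swap.
  - by apply: FS; split; [split; [exact: Sw.1|exact: tYb]|exact: erefl].
  - by rewrite -Psih.
have sXb : box T X0 (2 * R0) (sb, Xb) by split; [exact: sbT''|exact: (proj2 tbb)].
have aD : alpha * Ldist Xb Yb ^+ 2 <= 2 * e.
  have Sz : S ((tb, Xb), (sb, Xb)) by split; [exact: Sw.1|exact: sXb].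
  have := w2 _ Sz; rewrite /Psi /penalized /doubled /zdist /sdist /= (Ldist_sym Yb Xb).
  have yy : `|Ldist Xb Yh - Ldist Yb Yh| <= Ldist Xb Yb.
    by apply: le_trans (Ldist_lip _ _ _ _) _; rewrite (Ldist_xx Yh) addr0.
  have pp : `|phi2 (sb, law Xb) - phi2 (sb, law Yb)| < e.
    by apply: (deP (sb, Xb) (sb, Yb) sXb sbb); rewrite /sdist /= subrr normr0 add0r.
  have z2 : `|tb - tb| + Ldist Xb Xb = 0 by rewrite Ldist_xx subrr normr0 addr0.
  have z3 : `|sb - sb| = 0 by rewrite subrr normr0.
  exact: (doubling_le (ltW eta0) eta1 Dn0 (ltW De3) yy pp (Ldist_xx Xb) z2 z3).
have N2 : L2norm mu Xb <= 2 * R0 by apply: le_trans NX; rewrite lerDr.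
have omb := modulus_budget al0 Dn0 (o0 _ (normr_ge0 (tb - sb))) (L2norm_ge0 mu Xb) (ltW DR0) N2
  (ltW (dwP _ (normr_ge0 _) sw)) xoP.
have dl := cost_chain KL0 (LK tb (law Xb) (law Yb) u tbT'') (LK tb (law Yb) (law Yh) u tbT'')
  (dLP tb sb u tbT'' sbT'' sL) (LK sb (law Yh) (law Yb) u sbT'') (W2_law Xb Yb) (W2_law Yb Yh)
  (W2_Ldist_sym Yh Yb) ye.
exact: (final_absurd lam0 K0 (ltW e0) MI dl etac aD eK (xlP _ Dn0 (ltW Dxl)) omb).
Qed.

End ComparisonStep.

(** * Comparison *)

Section Comparison.
Context {R : realType} {d : nat} {U : metricType R}.
Variables (T : R) (f : R -> 'cV[R]_d -> P2 R d -> U -> 'cV[R]_d).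
Variables (L : R -> P2 R d -> U -> R).

Lemma eq_at_identity (mu : P2 R d) (X : L2 mu) (t : R) (phi : R * P2 R d -> R) :
  continuous_on (@tdist R d) (tspace T) phi -> 0 <= t <= T -> (forall x, X x = x) ->
  phi (t, mu) = phi (t, law X).
Proof.
move=> pc tT XE; apply/eqP; rewrite -subr_eq0 -normr_le0; apply/ler_addgt0Pr => e e0.
have [del del0 delP] := pc (t, mu) tT e e0.
rewrite add0r ltW//; apply: delP => //.
apply: le_lt_trans (tdist_le _ _ _ _) _; rewrite subrr normr0 add0r.
apply: le_lt_trans del0; rewrite -(L2norm0 mu X); apply: W2_le => A mA //.
by congr (mu _); apply/funext => x; rewrite /preimage /= XE.
Qed.

(** The differentials live on (0, T) and [comparison_step] needs t0 > 0, so time 0 is reached by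
    continuity. *)
Lemma le_at_initial_time (mu : P2 R d) (X : L2 mu) (phi1 phi2 : R * P2 R d -> R) : 0 < T ->
  continuous_on (@tdist R d) (tspace T) phi1 -> continuous_on (@tdist R d) (tspace T) phi2 ->
  (forall t, 0 < t <= T -> phi1 (t, law X) <= phi2 (t, law X)) ->
  phi1 (0, law X) <= phi2 (0, law X).
Proof.
move=> T0 pc1 pc2 H; apply/ler_addgt0Pr => e e0.
have z0 : tspace T (0, law X) by rewrite /tspace /= lexx ltW.
have e2 : 0 < e / 2 by rewrite divr_gt0.
have [d1 d10 d1P] := pc1 _ z0 _ e2; have [d2 d20 d2P] := pc2 _ z0 _ e2.
pose t := Num.min T (Num.min d1 d2 / 2).
have t0 : 0 < t by rewrite lt_min T0 divr_gt0// lt_min d10.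
have tT : 0 < t <= T by rewrite t0 ge_min lexx.
have tz : tspace T (t, law X) by case/andP: tT => *; rewrite /tspace /= ltW.
have td : tdist (0, law X) (t, law X) < Num.min d1 d2.
  apply: le_lt_trans (tdist_law _ _ _ _) _; rewrite L2norm0 addr0 sub0r normrN gtr0_norm//.
  have m0 : 0 < Num.min d1 d2 by rewrite lt_min d10.
  by apply: (@le_lt_trans _ _ (Num.min d1 d2 / 2)); [rewrite ge_min lexx orbT|lra].
move: td; rewrite lt_min => /andP[td1 td2].
have := d1P _ tz td1; have := d2P _ tz td2; have := H t tT.
by rewrite !ltr_norml => h /andP[h2 _] /andP[_ h3]; lra.
Qed.

(** The growth constant [c0] is uniform in the random variable, so one step length (8 c0)^-1 serves
    all initial states, and [0, T] is covered by finitely many steps. *)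
Lemma comparison (phi1 phi2 : R * P2 R d -> R) :
  0 < T -> @C1 R U -> C2 T f -> C3 T f -> C4 T L ->
  continuous_on (@tdist R d) (tspace T) phi1 -> continuous_on (@tdist R d) (tspace T) phi2 ->
  UC (@tdist R d) (tspace T) phi1 -> UC (@tdist R d) (tspace T) phi2 ->
  strict_subsolution T f L phi1 -> strict_supersolution T f L phi2 ->
  (forall mu, phi1 (T, mu) <= phi2 (T, mu)) ->
  forall t mu, 0 <= t <= T -> phi1 (t, mu) <= phi2 (t, mu).
Proof.
move=> T0 hC1 hC2 hC3 hC4 pc1 pc2 uc1 uc2 sub1 sup2 leT t mu tT.
have [c0 c00 fb] := drift_bounded mu T0 hC2 hC3 pc1 sub1.
have h0 : 0 < (8 * c0)^-1 by rewrite invr_gt0 mulr_gt0.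
(* Each step needs the terminal inequality at t1 for every X, not only near X0; the induction
   hypothesis therefore quantifies over all random variables on the same space. *)
have steps n : forall s, 0 < s <= T -> T - s <= n%:R * (8 * c0)^-1 ->
    forall X : L2 mu, phi1 (s, law X) <= phi2 (s, law X).
  elim: n => [|n IH] s /andP[s0 sT] sn X.
    by have -> : s = T by apply/eqP; rewrite eq_le sT -subr_le0 (le_trans sn) ?mul0r.
  pose t1 := Num.min T (s + (8 * c0)^-1).
  have st1 : s <= t1 by rewrite le_min sT lerDl ltW.
  have t1T : t1 <= T by rewrite ge_min lexx.
  have t1h : t1 - s <= (8 * c0)^-1 by rewrite lerBlDl ge_min lexx orbT.
  apply: (comparison_step X T0 hC1 hC2 hC3 hC4 pc1 pc2 uc1 uc2 sub1 sup2 c00 fb t1T _ s0 st1).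
    apply: IH; first by rewrite (lt_le_trans s0 st1).
    have nh : 0 <= n%:R * (8 * c0)^-1 by rewrite mulr_ge0// ltW.
    rewrite /t1; case: (leP T (s + (8 * c0)^-1)) => _; first by rewrite subrr.
    by rewrite opprD addrA lerBlDr; move: sn; rewrite -natr1 mulrDl mul1r.
  by move: t1h; rewrite -(ler_pM2l (mulr_gt0 (ltr0n R 8) c00)) divff// lt0r_neq0// mulr_gt0.
have all_times s (X : L2 mu) : 0 < s <= T -> phi1 (s, law X) <= phi2 (s, law X).
  move=> sT; pose n := (Num.truncn ((T - s) / (8 * c0)^-1)).+1.
  apply: (steps n) => //; rewrite -ler_pdivrMr//; apply: ltW.
  exact: truncnS_gt.
have [X XE] := L2_of (sqint_id mu).
rewrite (eq_at_identity pc1 tT XE) (eq_at_identity pc2 tT XE).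
case/andP: (tT); rewrite le_eqVlt => /predU1P[<- _|t0 t1]; last by apply: all_times; rewrite t0.
by apply: le_at_initial_time => // s; exact: all_times.
Qed.

End Comparison.

Theorem corollary7p3 (R : realType) (d : nat) (T : R) (U : metricType R)
    (f : R -> 'cV[R]_d -> P2 R d -> U -> 'cV[R]_d)
    (L : R -> P2 R d -> U -> R) (G : P2 R d -> R)
    (d_gt0 : (0 < d)%N) (T_gt0 : 0 < T)
    (hC1 : @C1 R U) (hC2 : C2 T f) (hC3 : C3 T f) (hC4 : C4 T L) (hC5 : C5 G)
    (phi1 phi2 : R * P2 R d -> R)
    (phi1_UC : UC (@tdist R d) (tspace T) phi1)
    (phi2_UC : UC (@tdist R d) (tspace T) phi2)
    (phi1_sol : strict_solution T f L G phi1)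
    (phi2_sol : strict_solution T f L G phi2) :
  forall (t : R) (mu : P2 R d), 0 <= t <= T -> phi1 (t, mu) = phi2 (t, mu).
Proof.
move=> t mu tT.
have [c1 sub1 sup1 G1] := phi1_sol; have [c2 sub2 sup2 G2] := phi2_sol.
apply/eqP; rewrite eq_le; apply/andP; split.
  apply: (comparison T_gt0 hC1 hC2 hC3 hC4 c1 c2 phi1_UC phi2_UC sub1 sup2) => // nu.
  by rewrite G1 G2.
apply: (comparison T_gt0 hC1 hC2 hC3 hC4 c2 c1 phi2_UC phi1_UC sub2 sup1) => // nu.
by rewrite G1 G2.
Qed.
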